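(* Let $\mathcal{G}$ be a locally compact Hausdorff groupoid whose unit space $\mathcal{G}^{(0)}$ is a CW-complex. Let $Tw(\mathcal{G})$ be the group of twists over $\mathcal{G}$ under Baer sum, and let $Tw_\tau(\mathcal{G})\subseteq Tw(\mathcal{G})$ be the subset of those twists $\mathcal{R}$ over $\mathcal{G}$ that admit a $(\mathcal{G},\mathcal{R})$-twisted vector bundle. Then $Tw_\tau(\mathcal{G})$ is a subgroup of $Tw(\mathcal{G})$.
   Context: A groupoid $\mathcal{G}$ (identified with its space of arrows) has unit space $\mathcal{G}^{(0)}$, source and range maps $s,r:\mathcal{G}\to\mathcal{G}^{(0)}$, and composable pairs $\mathcal{G}^{(2)}=\{(g_1,g_2): s(g_1)=r(g_2)\}$. It is a locally compact Hausdorff groupoid if $\mathcal{G}^{(0)},\mathcal{G},\mathcal{G}^{(2)}$ have locally compact Hausdorff topologies for which $s$, $r$, multiplication and inversion are continuous. $\mathbb{T}$ is the unit circle in $\mathbb{C}$. Twist. A twist ($\mathbb{T}$-central extension) over $\mathcal{G}$ consists of: (1) a locally compact Hausdorff groupoid $\mathcal{R}$ with unit space $\mathcal{G}^{(0)}$ and a continuous groupoid homomorphism $\pi:\mathcal{R}\to\mathcal{G}$ restricting to the identity on $\mathcal{G}^{(0)}$; (2) a left $\mathbb{T}$-action on $\mathcal{R}$ making $\pi:\mathcal{R}\to\mathcal{G}$ a left principal $\mathbb{T}$-bundle; (3) the compatibility $(z_1r_1)(z_2r_2)=z_1z_2(r_1r_2)$ for all $z_1,z_2\in\mathbb{T}$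 and all composable $(r_1,r_2)\in\mathcal{R}^{(2)}$. $Tw(\mathcal{G})$ is the set of twists over $\mathcal{G}$ (up to isomorphism of twists). Group structure. The Baer sum of $\mathcal{R}_1,\mathcal{R}_2$ is $\mathcal{R}_1+\mathcal{R}_2=\{(r_1,r_2)\in\mathcal{R}_1\times\mathcal{R}_2:\pi_1(r_1)=\pi_2(r_2)\}/\sim$, where $(r_1,r_2)\sim(zr_1,\overline{z}r_2)$ for $z\in\mathbb{T}$, with $\mathbb{T}$-action $z\cdot[(r_1,r_2)]=[(zr_1,r_2)]$. The identity is the trivial twist $\mathcal{G}\times\mathbb{T}$; the inverse of $\mathcal{R}$ is $\overline{\mathcal{R}}$, the same groupoid with the conjugate $\mathbb{T}$-action $z\cdot\overline{r}=\overline{\overline{z}\cdot r}$. Actions and twisted vector bundles. For a groupoid $\mathcal{H}$, an $\mathcal{H}$-space is a locally trivial fiber bundle $J:P\to\mathcal{H}^{(0)}$ with a continuous map $\{(h,p)\in \mathcal{H}\times P:s(h)=J(p)\}\to P$, $(h,p)\mapsto h\cdot p$, such that $J(p)\cdot p=p$, $J(h\cdot p)=r(h)$, and $g\cdot(h\cdot p)=(gh)\cdot p$ whenever defined. An $\mathcal{H}$-vector bundle is a (complex, finite-rank, nowhere zero) vector bundle over $\mathcal{H}^{(0)}$ that is an $\mathcal{H}$-space, the action being fiberwise linear. For a twist $\mathcal{R}$ over $\mathcal{G}$, a $(\mathcal{G},\mathcal{R})$-twisted vector bundle is an $\mathcal{R}$-vector bundle $J:E\to\mathcal{G}^{(0)}$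 such that $(z\cdot r)\cdot e=z(r\cdot e)$ for all $z\in\mathbb{T}$, $r\in\mathcal{R}$, $e\in E$ with $s(r)=J(e)$, where $z$ acts on the right-hand side by scalar multiplication. *)

(* Defs.v *)
From HB Require Import structures.
From mathcomp Require Import all_boot all_order all_algebra.
From mathcomp Require Import complex.
From mathcomp Require Import all_classical all_reals all_analysis.

Set Implicit Arguments.
Unset Strict Implicit.
Unset Printing Implicit Defensive.

Import Order.TTheory GRing.Theory Num.Theory.
Import numFieldNormedType.Exports.

Local Open Scope classical_set_scope.
Local Open Scope ring_scope.
Local Open Scope quotient_scope.

(* Conventions: partial maps (multiplication on composable pairs, actions,
   inverses of local trivializations) are total functions whose values outside
   their domain of definition are never constrained; continuity on the domain
   is continuity for the subspace topology, "{within D, continuous f}".       *)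

Record homeo_on (S T : topologicalType) (A : set S) (B : set T)
    (f : S -> T) (g : T -> S) : Prop := {
  homeo_fun : set_fun A B f;
  homeo_inv : set_fun B A g;
  homeo_funK : {in A, cancel f g};
  homeo_invK : {in B, cancel g f};
  homeo_cts : {within A, continuous f};
  homeo_inv_cts : {within B, continuous g}
}.

Definition lc_hausdorff (T : topologicalType) : Prop :=
  hausdorff_space T /\ locally_compact [set: T].

Section CW.
Variable R : realType.

Definition euclid_sq n (x : 'rV[R]_n) : R := \sum_i x 0 i ^+ 2.
Definition disk n : set 'rV[R]_n := [set x | euclid_sq x <= 1].
Definition open_disk n : set 'rV[R]_n := [set x | euclid_sq x < 1].
Definition sphere n : set 'rV[R]_n := [set x | euclid_sq x = 1].

(* Whitehead's definition. [chi i] is the characteristic map of the cell [i];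
   the (open) cell itself is [chi i @` open_disk (dim i)].                    *)
Record is_cell_structure (X : topologicalType) (I : Type) (dim : I -> nat)
    (chi : forall i, 'rV[R]_(dim i) -> X) : Prop := {
  chi_cts : forall i, {within disk (n := dim i), continuous (chi i)};
  chi_homeo : forall i, exists psi : X -> 'rV[R]_(dim i),
    homeo_on (open_disk (n := dim i)) (chi i @` open_disk (n := dim i))
             (chi i) psi;
  cells_disjoint : trivIset setT (fun i => chi i @` open_disk (n := dim i));
  cells_cover : \bigcup_i (chi i @` open_disk (n := dim i)) = setT;
  closure_finite : forall i, exists J : set I,
    [/\ finite_set J, (forall j, J j -> (dim j < dim i)%N) &
        chi i @` sphere (n := dim i) `<=`
          \bigcup_(j in J) (chi j @` open_disk (n := dim j))];
  weak_closed : forall A : set X,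
    (forall i, closed (disk (n := dim i) `&` chi i @^-1` A)) -> closed A
}.

Definition cw_complex (X : topologicalType) : Prop :=
  hausdorff_space X /\
  exists (I : Type) (dim : I -> nat) (chi : forall i, 'rV[R]_(dim i) -> X),
    is_cell_structure chi.

End CW.

Section Circle.
Variable R : realType.

(* Going through [numClosedFieldType] gives C its norm topology. *)
Definition cplx : numClosedFieldType := R[i].

Definition circle_set : set cplx := [set z | `|z| = 1].
Definition circle : topologicalType := circle_set.
Definition circle_val (z : circle) : cplx := set_val z.

Lemma circle_valP (z : circle) : `|circle_val z| = 1.
Proof. exact: (set_valP z). Qed.

Definition mk_circle (z : cplx) (hz : `|z| = 1) : circle :=
  SigSub (mem_set hz : z \in circle_set).

Lemma mk_circleK (z : cplx) (hz : `|z| = 1) : circle_val (mk_circle hz) = z.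
Proof. by []. Qed.

Lemma circle_val_inj : injective circle_val.
Proof. exact: val_inj. Qed.

Lemma circle1_subproof : `|1 : cplx| = 1.
Proof. exact: normr1. Qed.
Definition circle1 : circle := mk_circle circle1_subproof.

Lemma circleM_subproof (z w : circle) : `|circle_val z * circle_val w| = 1.
Proof. by rewrite normrM !circle_valP mulr1. Qed.
Definition circleM (z w : circle) : circle := mk_circle (circleM_subproof z w).

Lemma circleC_subproof (z : circle) : `|(circle_val z)^*| = 1.
Proof. by rewrite norm_conjC circle_valP. Qed.
Definition circleC (z : circle) : circle := mk_circle (circleC_subproof z).

Lemma circleMC z w : circleM z w = circleM w z.
Proof. by apply: circle_val_inj; rewrite !mk_circleK mulrC. Qed.

Lemma circleCM z w : circleC (circleM z w) = circleM (circleC z) (circleC w).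
Proof. by apply: circle_val_inj; rewrite !mk_circleK rmorphM. Qed.

Lemma circleC1 : circleC circle1 = circle1.
Proof. by apply: circle_val_inj; rewrite !mk_circleK rmorph1. Qed.

Lemma circleCK : involutive circleC.
Proof. by move=> z; apply: circle_val_inj; rewrite !mk_circleK conjCK. Qed.

Lemma circleCr z : circleM z (circleC z) = circle1.
Proof.
by apply: circle_val_inj; rewrite !mk_circleK -normCK circle_valP expr1n.
Qed.

End Circle.

Section Groupoids.
Variable X : topologicalType.

Record groupoid_data := GroupoidData {
  arrows :> topologicalType;
  src : arrows -> X;
  rng : arrows -> X;
  unit_at : X -> arrows;
  gmul : arrows -> arrows -> arrows;
  ginv : arrows -> arrows
}.

Definition composable (G : groupoid_data) : set (G * G) :=
  [set p | src p.1 = rng p.2].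

Record is_groupoid (G : groupoid_data) : Prop := {
  src_unit : forall x, src (unit_at G x) = x;
  rng_unit : forall x, rng (unit_at G x) = x;
  src_mul : forall g h : G, src g = rng h -> src (gmul g h) = src h;
  rng_mul : forall g h : G, src g = rng h -> rng (gmul g h) = rng g;
  gmulA : forall g h k : G, src g = rng h -> src h = rng k ->
    gmul g (gmul h k) = gmul (gmul g h) k;
  gmul1l : forall g : G, gmul (unit_at G (rng g)) g = g;
  gmul1r : forall g : G, gmul g (unit_at G (src g)) = g;
  src_inv : forall g : G, src (ginv g) = rng g;
  rng_inv : forall g : G, rng (ginv g) = src g;
  gmulV : forall g : G, gmul g (ginv g) = unit_at G (rng g);
  gmulVl : forall g : G, gmul (ginv g) g = unit_at G (src g)
}.

(* Continuity of [unit_at] (together with that of [src]) says that it is an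
   embedding of the unit space in the space of arrows.                        *)
Record lch_groupoid (G : groupoid_data) : Prop := {
  lch_is_groupoid :> is_groupoid G;
  lch_unit_space : lc_hausdorff X;
  lch_arrows : lc_hausdorff G;
  lch_composable : lc_hausdorff (composable (G := G));
  src_cts : continuous (@src G);
  rng_cts : continuous (@rng G);
  unit_cts : continuous (@unit_at G);
  ginv_cts : continuous (@ginv G);
  gmul_cts : {within composable (G := G), continuous (fun p => gmul p.1 p.2)}
}.

Record groupoid_hom (G H : groupoid_data) (f : G -> H) : Prop := {
  hom_src : forall g, src (f g) = src g;
  hom_rng : forall g, rng (f g) = rng g;
  hom_unit : forall x, f (unit_at G x) = unit_at H x;
  hom_mul : forall g h, src g = rng h -> f (gmul g h) = gmul (f g) (f h)
}.

End Groupoids.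

Section Twists.
Variables (R : realType) (X : topologicalType) (G : groupoid_data X).
Local Notation TT := (circle R).

Record principal_circle_bundle (P B : topologicalType) (p : P -> B)
    (act : TT -> P -> P) : Prop := {
  pcb_cts : continuous p;
  pcb_act_cts : continuous (fun q : TT * P => act q.1 q.2);
  pcb_act1 : forall r, act (circle1 R) r = r;
  pcb_actM : forall z w r, act (circleM z w) r = act z (act w r);
  pcb_act_fiber : forall z r, p (act z r) = p r;
  pcb_loc_triv : forall b, exists (U : set B) (phi : B * TT -> P)
      (psi : P -> B * TT),
    [/\ open U, U b, homeo_on (U `*` setT) (p @^-1` U) phi psi,
        (forall c z, U c -> p (phi (c, z)) = c) &
        (forall c z w, U c -> phi (c, circleM z w) = act z (phi (c, w)))]
}.

Record twist_data := TwistData {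
  tw_gpd :> groupoid_data X;
  tw_pi : tw_gpd -> G;
  tw_act : TT -> tw_gpd -> tw_gpd
}.

Record is_twist (T : twist_data) : Prop := {
  tw_lch : lch_groupoid T;
  tw_hom : groupoid_hom (@tw_pi T);
  tw_bundle : principal_circle_bundle (@tw_pi T) (@tw_act T);
  tw_compat : forall z1 z2 (r1 r2 : T), src r1 = rng r2 ->
    gmul (tw_act z1 r1) (tw_act z2 r2) = tw_act (circleM z1 z2) (gmul r1 r2)
}.

Record twist := Twist { tw_data :> twist_data; twistP : is_twist tw_data }.

Definition twist_iso (S T : twist_data) : Prop :=
  exists (f : S -> T) (g : T -> S),
    [/\ homeo_on setT setT f g, groupoid_hom f,
        (forall r, tw_pi (f r) = tw_pi r) &
        (forall z r, f (tw_act z r) = tw_act z (f r))].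

Definition trivial_twist : twist_data := {|
  tw_gpd := {|
    arrows := (G * TT)%type;
    src := fun p => src p.1;
    rng := fun p => rng p.1;
    unit_at := fun x => (unit_at G x, circle1 R);
    gmul := fun p q => (gmul p.1 q.1, circleM p.2 q.2);
    ginv := fun p => (ginv p.1, circleC p.2) |};
  tw_pi := fun p => p.1;
  tw_act := fun z p => (p.1, circleM z p.2) |}.

Definition conj_twist (T : twist_data) : twist_data := {|
  tw_gpd := T;
  tw_pi := @tw_pi T;
  tw_act := fun z r => tw_act (circleC z) r |}.

Section BaerSum.
Variables T1 T2 : twist.

Definition fiber_prod : set (T1 * T2) :=
  [set p | tw_pi p.1 = tw_pi p.2].

(* the subspace topology of T1 * T2 *)
Definition fiber_prod_space : topologicalType := fiber_prod.

Definition fp1 (p : fiber_prod_space) : T1 := (set_val p).1.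
Definition fp2 (p : fiber_prod_space) : T2 := (set_val p).2.

Definition baer_rel : rel fiber_prod_space := fun p q =>
  `[< exists z : TT,
        fp1 q = tw_act z (fp1 p) /\ fp2 q = tw_act (circleC z) (fp2 p) >].

Lemma baer_rel_equiv : equiv_class_of baer_rel.
Proof.
have B1 := tw_bundle (twistP T1); have B2 := tw_bundle (twistP T2).
have sym p q : baer_rel p q -> baer_rel q p.
  move=> /asboolP[z [e1 e2]]; apply/asboolP; exists (circleC z); rewrite e1 e2.
  rewrite -!(pcb_actM B1) -!(pcb_actM B2) circleMC circleCr.
  by rewrite circleMC circleCr (pcb_act1 B1) (pcb_act1 B2).
split.
- move=> p; apply/asboolP; exists (circle1 R).
  by rewrite circleC1 (pcb_act1 B1) (pcb_act1 B2).
- by move=> p q; apply/idP/idP; exact: sym.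
- move=> q p r /asboolP[z [e1 e2]] /asboolP[w [e3 e4]]; apply/asboolP.
  exists (circleM w z); rewrite circleCM (pcb_actM B1) (pcb_actM B2).
  by rewrite e3 e4 e1 e2.
Qed.

Canonical baer_equiv : equiv_rel fiber_prod_space := EquivRelPack baer_rel_equiv.

Definition baer_space : topologicalType :=
  quotient_topology {eq_quot baer_equiv}.

(* The class [(r1, r2)] when (r1, r2) lies in the fiber product; the default
   [x] is only there because the fiber product is a subtype.                  *)
Definition baer_class (x : baer_space) (r1 : T1) (r2 : T2) : baer_space :=
  \pi_baer_space (insubd (repr x) (r1, r2)).

Lemma baer_unit_subproof x : fiber_prod (unit_at T1 x, unit_at T2 x).
Proof.
by rewrite /fiber_prod /= (hom_unit (tw_hom (twistP T1)))
  (hom_unit (tw_hom (twistP T2))).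
Qed.

Definition baer_unit (x : X) : baer_space :=
  \pi_baer_space (SigSub (mem_set (baer_unit_subproof x)) : fiber_prod_space).

(* All operations are componentwise on representatives; [twistP T1] and
   [twistP T2] make them independent of the choice of representatives.        *)
Definition baer_sum : twist_data := {|
  tw_gpd := {|
    arrows := baer_space;
    src := fun x => src (fp1 (repr x));
    rng := fun x => rng (fp1 (repr x));
    unit_at := baer_unit;
    gmul := fun x y => baer_class x (gmul (fp1 (repr x)) (fp1 (repr y)))
                                    (gmul (fp2 (repr x)) (fp2 (repr y)));
    ginv := fun x => baer_class x (ginv (fp1 (repr x))) (ginv (fp2 (repr x))) |};
  tw_pi := fun x => tw_pi (fp1 (repr x));
  tw_act := fun z x => baer_class x (tw_act z (fp1 (repr x))) (fp2 (repr x)) |}.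

End BaerSum.

(* An element of Tw(G) is an isomorphism class of twists, as a predicate on
   twists: [set twist] is ruled out by the universe of [topologicalType].     *)
Definition tw_classes : Type := twist -> Prop.

Definition twist_class (T : twist) : tw_classes := fun S => twist_iso S T.
Definition Tw (a : tw_classes) : Prop := exists T : twist, a = twist_class T.

Definition tw_zero : tw_classes := fun S => twist_iso S trivial_twist.
Definition tw_add (a b : tw_classes) : tw_classes := fun S =>
  exists T1 T2 : twist, [/\ a T1, b T2 & twist_iso S (baer_sum T1 T2)].
Definition tw_opp (a : tw_classes) : tw_classes := fun S =>
  exists2 T : twist, a T & twist_iso S (conj_twist T).

End Twists.

Section VectorBundles.
Variables (R : realType) (X : topologicalType).
Local Notation C := (cplx R).

(* [vb_add e e'] is meaningful only when e and e' are in the same fiber. *)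
Record vbundle_data := VBundleData {
  vb_total :> topologicalType;
  vb_proj : vb_total -> X;
  vb_add : vb_total -> vb_total -> vb_total;
  vb_scale : C -> vb_total -> vb_total
}.

(* The trivializations are bijective on fibers and compatible with the
   operations, so each fiber is a complex vector space of finite dimension n
   (with zero vector [phi (y, 0)]); n may depend on the connected component,
   and 0 < n says that the bundle is nowhere zero.                            *)
Record is_vbundle (E : vbundle_data) : Prop := {
  vb_proj_cts : continuous (@vb_proj E);
  vb_loc_triv : forall x, exists (U : set X) (n : nat)
      (phi : X * 'rV[C]_n -> E) (psi : E -> X * 'rV[C]_n),
    [/\ open U /\ U x, (0 < n)%N,
        homeo_on (U `*` setT) (@vb_proj E @^-1` U) phi psi,
        (forall y v, U y -> vb_proj (phi (y, v)) = y) &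
        (forall y v w, U y ->
           phi (y, v + w) = vb_add (phi (y, v)) (phi (y, w))) /\
        (forall y (a : C) v, U y ->
           phi (y, a *: v) = vb_scale a (phi (y, v)))]
}.

Record is_groupoid_vbundle (H : groupoid_data X) (E : vbundle_data)
    (act : H -> E -> E) : Prop := {
  gvb_vbundle : is_vbundle E;
  gvb_act_cts : {within [set p : H * E | src p.1 = vb_proj p.2],
                  continuous (fun p => act p.1 p.2)};
  gvb_act_unit : forall e : E, act (unit_at H (vb_proj e)) e = e;
  gvb_proj_act : forall h (e : E), src h = vb_proj e ->
    vb_proj (act h e) = rng h;
  gvb_actM : forall g h (e : E), src g = rng h -> src h = vb_proj e ->
    act g (act h e) = act (gmul g h) e;
  gvb_actD : forall h (e e' : E), src h = vb_proj e -> src h = vb_proj e' ->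
    act h (vb_add e e') = vb_add (act h e) (act h e');
  gvb_actZ : forall h (a : C) (e : E), src h = vb_proj e ->
    act h (vb_scale a e) = vb_scale a (act h e)
}.

Definition is_twisted_vbundle (G : groupoid_data X) (T : twist_data R G)
    (E : vbundle_data) (act : T -> E -> E) : Prop :=
  is_groupoid_vbundle act /\
  forall (z : circle R) (r : T) (e : E), src r = vb_proj e ->
    act (tw_act z r) e = vb_scale (circle_val z) (act r e).

Definition admits_twisted_vbundle (G : groupoid_data X) (T : twist_data R G) :
    Prop :=
  exists (E : vbundle_data) (act : T -> E -> E), is_twisted_vbundle act.

End VectorBundles.

Definition Tw_tau (R : realType) (X : topologicalType) (G : groupoid_data X)
    (a : tw_classes R G) : Prop :=
  exists2 T : twist R G, admits_twisted_vbundle T & a = twist_class T.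

Record is_group (T : Type) (A : T -> Prop) (op : T -> T -> T) (e : T)
    (inv : T -> T) : Prop := {
  group_op : forall a b, A a -> A b -> A (op a b);
  group_unit : A e;
  group_inv : forall a, A a -> A (inv a);
  group_assoc : forall a b c, A a -> A b -> A c ->
    op a (op b c) = op (op a b) c;
  group_1l : forall a, A a -> op e a = a;
  group_1r : forall a, A a -> op a e = a;
  group_Vl : forall a, A a -> op (inv a) a = e;
  group_Vr : forall a, A a -> op a (inv a) = e
}.

Definition is_subgroup (T : Type) (B A : T -> Prop) (op : T -> T -> T) (e : T)
    (inv : T -> T) : Prop :=
  [/\ is_group A op e inv, (forall a, B a -> A a) & is_group B op e inv].

(* Main.v *)
Require Import Defs.
From HB Require Import structures.
From mathcomp Require Import all_boot all_order all_algebra.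
From mathcomp Require Import complex.
From mathcomp Require Import all_classical all_reals all_analysis.
From mathcomp Require Import lra.

(** Twists over [G] form a group under Baer sum, and the twists that carry a
    twisted vector bundle are closed under the group operations: the trivial
    twist acts on the trivial line bundle by scalars; if [E] is twisted by [T],
    the same bundle with conjugate scalars is twisted by the conjugate of [T];
    and if [E1], [E2] are twisted by [T1], [T2], then [E1] tensor [E2], on which
    the class of [(r1, r2)] acts by [r1] tensor [r2], is twisted by the Baer
    sum: replacing [(r1, r2)] by [(z r1, z^* r2)] does not change the action,
    because [z z^* = 1].

    Two ideas carry the group structure.  First, a circle bundle is the same
    thing as a free action with local sections and a continuous division
    (r, r') |-> r' / r ([pcb_local], [pcb_intro]); since equivariant maps
    preserve division, a continuous equivariant map of circle bundles over one
    base is a homeomorphism ([pcb_morphism_homeo]), and a morphism of twists is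
    an isomorphism ([twist_morphism_iso]).  Second, the projection of the fiber
    product onto the Baer sum is open ([baer_open_map]), so that continuity on
    the Baer sum, and on products involving it, can be tested on
    representatives.  Together they give [baer_is_twist], and show that a
    bimultiplicative, bihomogeneous continuous pairing of [T1] and [T2] with
    values in a twist identifies that twist with the Baer sum
    ([pairing_iso]).  Every group law then amounts to writing down a pairing:
    (r1, r2) |-> [r2, r1] for commutativity, (r1, [r2, r3]) |-> [[r1, r2], r3]
    for associativity, ((g, z), r) |-> z r for the unit, and (r, s) |-> s / r
    for the inverse.

    For the tensor product, a chart is chosen at every point of the base.  Over
    [x] the fiber is then a space of matrices, and its total space receives the
    finest topology that makes all charts of [E1] and [E2] induce continuous
    maps ([tens_open]).  Transition functions and group actions are both
    matrices of fiberwise linear maps in two charts ([chart_mx]), which depend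
    continuously on parameters ([chart_mx_cvg]); from this follow local
    triviality ([tens_is_vbundle]) and continuity of the action
    ([tens_act_cts]). *)

Set Implicit Arguments.
Unset Strict Implicit.
Unset Printing Implicit Defensive.

Import Order.TTheory GRing.Theory Num.Theory.
Import numFieldNormedType.Exports.

Local Open Scope classical_set_scope.
Local Open Scope ring_scope.
Local Open Scope quotient_scope.

(** * Convergence and continuity on subsets *)

Section Convergence.

(** Partial operations are continuous on their domain only; this composition
    rule is how such a continuity is used along an arbitrary filter. *)
Lemma cvg_within_comp (Z : Type) (Y W : topologicalType) (A : set Y)
    (f : Y -> W) (h : Z -> Y) (F : set_system Z) (y : Y) :
  Filter F -> {within A, continuous f} -> A y -> h @ F --> y ->
  (\forall z \near F, A (h z)) -> f (h z) @[z --> F] --> f y.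
Proof.
move=> FF /subspace_continuousP cf Ay hF nA B fB.
have FB : F (h @^-1` [set y' | A y' -> B (f y')]) := hF _ (cf y Ay B fB).
by apply: (filterS2 _ _ nA FB) => z Az; apply.
Qed.

Lemma cvg_cts (Z : Type) (Y W : topologicalType) (f : Y -> W) (h : Z -> Y)
    (F : set_system Z) (y : Y) :
  Filter F -> continuous f -> h @ F --> y -> f (h z) @[z --> F] --> f y.
Proof. by move=> FF cf hF; exact: cvg_comp hF (cf y). Qed.

Lemma cvg_at_comp (Z : Type) (Y W : topologicalType) (f : Y -> W) (h : Z -> Y)
    (F : set_system Z) (y : Y) (w : W) :
  Filter F -> f @ nbhs y --> w -> h @ F --> y -> f (h z) @[z --> F] --> w.
Proof. by move=> FF fy hF; exact: cvg_comp hF fy. Qed.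

Lemma cvg_prod (Z : Type) (Y W : topologicalType) (f : Z -> Y) (g : Z -> W)
    (F : set_system Z) (y : Y) (w : W) :
  Filter F -> f @ F --> y -> g @ F --> w -> (f z, g z) @[z --> F] --> (y, w).
Proof. by move=> FF fy gw; exact: (cvg_pair fy gw). Qed.

Lemma cvg_near_eq (Z : Type) (W : topologicalType) (f g : Z -> W)
    (F : set_system Z) (y : W) :
  Filter F -> (\forall z \near F, f z = g z) -> g @ F --> y -> f @ F --> y.
Proof.
move=> FF fg gF B /gF gB.
by apply: (filterS2 _ _ fg gB) => z; rewrite /preimage /= => ->.
Qed.

Lemma near_withinA (Y : topologicalType) (A : set Y) (y : Y) :
  \forall z \near within A (nbhs y), A z.
Proof. exact: withinT. Qed.

Lemma cvg_open (Z : Type) (Y : topologicalType) (h : Z -> Y) (F : set_system Z)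
    (y : Y) (U : set Y) :
  h @ F --> y -> open U -> U y -> \forall z \near F, U (h z).
Proof. by move=> hF oU Uy; apply: hF; exact: open_nbhs_nbhs. Qed.

Lemma cts_comp (Y Z W : topologicalType) (f : Y -> Z) (g : Z -> W) :
  continuous f -> continuous g -> continuous (fun y => g (f y)).
Proof. by move=> cf cg y; exact: cvg_comp (cf y) (cg (f y)). Qed.

Lemma fst_cts (Y Z : topologicalType) : continuous (@fst Y Z).
Proof. by move=> p; exact: cvg_fst. Qed.

Lemma snd_cts (Y Z : topologicalType) : continuous (@snd Y Z).
Proof. by move=> p; exact: cvg_snd. Qed.

Lemma cvg_fst_within (Y Z : topologicalType) (A : set (Y * Z)) (p : Y * Z) :
  fst @ within A (nbhs p) --> p.1.
Proof. by apply: cvg_within_filter; exact: cvg_fst. Qed.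

Lemma cvg_snd_within (Y Z : topologicalType) (A : set (Y * Z)) (p : Y * Z) :
  snd @ within A (nbhs p) --> p.2.
Proof. by apply: cvg_within_filter; exact: cvg_snd. Qed.

Lemma within_comp (Y Z W : topologicalType) (A : set Y) (B : set Z)
    (f : Z -> W) (h : Y -> Z) :
  {within B, continuous f} -> {within A, continuous h} -> set_fun A B h ->
  {within A, continuous (f \o h)}.
Proof.
move=> cf /subspace_continuousP ch AB; apply/subspace_continuousP => y Ay.
apply: (@cvg_within_comp _ _ _ B f h); [exact: cf|exact: AB|exact: ch|].
by apply: filterS (near_withinA A y) => z; exact: AB.
Qed.

End Convergence.

(** * Open maps *)

Section OpenMaps.
Variables (Y Z : topologicalType) (q : Y -> Z).

Definition open_map := forall y (B : set Z), nbhs y (q @^-1` B) -> nbhs (q y) B.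

Lemma open_mapP :
  (forall U : set Y, open U -> open (q @` U)) -> open_map.
Proof.
move=> oq y B; rewrite !nbhsE => -[U [oU Uy] UB].
exists (q @` U); first by split; [exact: oq|exists y].
by move=> _ [u Uu <-]; exact: UB.
Qed.

Lemma cvg_open_map (W : Type) (G : set_system W) (A : set Z) (f : Z -> W) y :
  open_map -> f (q y') @[y' --> within (q @^-1` A) (nbhs y)] --> G ->
  f @ within A (nbhs (q y)) --> G.
Proof. by move=> oq cf B /cf; exact: oq. Qed.

(** Continuity of a map on a subset [A] descends along an open surjection,
    even when [A] is neither open nor closed. *)
Lemma cts_open_map (W : topologicalType) (A : set Z) (f : Z -> W) :
  open_map -> (forall z, exists y, q y = z) ->
  {within q @^-1` A, continuous (f \o q)} -> {within A, continuous f}.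
Proof.
move=> oq sq /subspace_continuousP cf; apply/subspace_continuousP => z Az.
have [y yz] := sq z; rewrite -yz in Az *.
by apply: cvg_open_map => //; exact: cf.
Qed.

End OpenMaps.

Lemma open_map_id (Y : topologicalType) : open_map (@id Y).
Proof. by []. Qed.

Lemma open_map_prod (Y Z Y' Z' : topologicalType) (q : Y -> Z) (q' : Y' -> Z') :
  open_map q -> open_map q' -> open_map (fun p => (q p.1, q' p.2)).
Proof.
move=> oq oq' [y y'] B [[P P'] /= [Py Py'] PB].
exists (q @` P, q' @` P') => /=.
  have sP (S T : Type) (h : S -> T) (D : set S) : D `<=` h @^-1` (h @` D).
    by move=> u Du; exists u.
  have yP : nbhs y (q @^-1` (q @` P)) by apply: filterS Py; exact: sP.
  have yP' : nbhs y' (q' @^-1` (q' @` P')) by apply: filterS Py'; exact: sP.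
  by split; [exact: oq|exact: oq'].
by move=> [_ _] [/= [u Pu <-] [v Pv <-]]; exact: (PB (u, v)).
Qed.

(** * Locally compact Hausdorff spaces *)

Section LocallyCompact.

Lemma lc_hausdorffI (T : topologicalType) :
  hausdorff_space T -> (forall x : T, exists2 K, nbhs x K & compact K) ->
  lc_hausdorff T.
Proof.
move=> hT lT; split=> // x _; have [K xK cK] := lT x.
exists K; last by split=> //; exact: compact_closed.
by rewrite withinET.
Qed.

(** A locally compact Hausdorff space is regular, so a compact neighborhood
    contains closed, hence compact, neighborhoods that are arbitrarily small. *)
Lemma lc_hausdorff_small (T : topologicalType) (x : T) (U : set T) :
  lc_hausdorff T -> nbhs x U -> exists K, [/\ nbhs x K, compact K & K `<=` U].
Proof.
move=> [hT lT] xU; have [K xK [cK clK]] := lT x Logic.I.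
rewrite withinET in xK.
have [V xV VU] := compact_regular hT cK xK xU.
exists (K `&` closure V); split.
- by apply: filterI => //; apply: filterS xV; exact: subset_closure.
- by apply: compact_closedI => //; exact: closed_closure.
- by move=> y [_] /VU.
Qed.

Lemma cluster_cvg (S T : topologicalType) (f : S -> T) (x y : S) :
  {for x, continuous f} -> {for y, continuous f} -> cluster (nbhs x) y ->
  cluster (nbhs (f x)) (f y).
Proof.
move=> fx fy xy A B /fx /= xA /fy /= yB.
by have [z [Az Bz]] := xy _ _ xA yB; exists (f z).
Qed.

Lemma lc_hausdorff_prod (S T : topologicalType) :
  lc_hausdorff S -> lc_hausdorff T -> lc_hausdorff (S * T)%type.
Proof.
move=> lS lT; have [hS _] := lS; have [hT _] := lT; apply: lc_hausdorffI.
  move=> [a b] [c d] cl; congr (_, _).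
    by apply: hS; apply: (@cluster_cvg _ _ fst _ _ _ _ cl); exact: cvg_fst.
  by apply: hT; apply: (@cluster_cvg _ _ snd _ _ _ _ cl); exact: cvg_snd.
move=> [a b]; have [K [aK cK _]] := @lc_hausdorff_small _ a setT lS filterT.
have [L [bL cL _]] := @lc_hausdorff_small _ b setT lT filterT.
by exists (K `*` L); [exists (K, L)|exact: compact_setX].
Qed.

Lemma set_val_cts (T : topologicalType) (A : set T) : continuous (@set_val T A).
Proof. exact: (@initial_continuous A T set_val). Qed.

Lemma cvg_set_val (T : topologicalType) (A : set T) (Z : Type)
    (F : set_system Z) (h : Z -> A) (a : A) :
  Filter F -> set_val (h z) @[z --> F] --> set_val a -> h @ F --> a.
Proof.
move=> FF hF B [_ [[V oV <-] Va] sB].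
have aV : nbhs (set_val a) V by apply: open_nbhs_nbhs; split.
have FV : F (h @^-1` (set_val @^-1` V)) := hF _ aV.
suff : F (h @^-1` B) by [].
by apply: filterS FV => z; exact: (sB (h z)).
Qed.

Lemma compact_set_val (T : topologicalType) (A K : set T) :
  compact (K `&` A) -> compact (set_val @^-1` K : set A).
Proof.
move=> cKA F FF FK; have FKA : (set_val @ F) (K `&` A).
  suff : F (set_val @^-1` (K `&` A)) by [].
  by apply: filterS FK => z Kz; split=> //; exact: set_valP.
have [p [[Kp Ap] cl]] := cKA _ _ FKA.
exists (SigSub (mem_set Ap) : A); split=> //.
move=> B C FB [_ [[V oV <-] Va] sC].
have FB' : F (set_val @^-1` (set_val @` B)).
  by apply: filterS FB => z Bz; exists z.
have pV : nbhs p V by apply: open_nbhs_nbhs; split.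
have [_ [[z Bz <-] Vz]] := cl _ _ FB' pV.
by exists z; split=> //; exact: (sC z).
Qed.

Lemma lc_hausdorff_closed (T : topologicalType) (A : set T) :
  lc_hausdorff T -> closed A -> lc_hausdorff A.
Proof.
move=> lT cA; have [hT _] := lT; apply: lc_hausdorffI.
  move=> x y cl; apply: val_inj; apply: hT.
  by apply: (@cluster_cvg _ _ set_val _ _ _ _ cl);
    exact: (@set_val_cts T A).
move=> x; have [K [xK cK _]] := @lc_hausdorff_small _ (set_val x) setT lT
  filterT.
exists (set_val @^-1` K); first exact: (@set_val_cts _ _ x _ xK).
by apply: compact_set_val; exact: compact_closedI.
Qed.

Lemma closed_eq (S T : topologicalType) (f g : S -> T) :
  hausdorff_space T -> continuous f -> continuous g ->
  closed [set x | f x = g x].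
Proof.
move=> hT cf cg x cl; apply: hT => A B fA gB.
have xA : nbhs x (f @^-1` A) := cf x A fA.
have xB : nbhs x (g @^-1` B) := cg x B gB.
have [y [/= e [/= Ay By]]] := cl _ (filterI xA xB).
by exists (f y); split=> //; rewrite e.
Qed.

End LocallyCompact.

(** * The circle *)

Section CircleTopology.
Variable R : realType.
Local Notation C := (cplx R).
Local Notation TT := (circle R).

Lemma conj_cts : continuous (fun z : C => z^*).
Proof.
move=> z A; have nP := @nbhs_ballP C C^o.
move=> /nP[e /= e0 sA]; apply/nP; exists e => //= w.
rewrite -ball_normE /= => h; apply: sA.
by rewrite -ball_normE /= -rmorphB norm_conjC.
Qed.

Lemma circle_val_cts : continuous (@circle_val R).
Proof. exact: (@set_val_cts C (@circle_set R)). Qed.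

Lemma cvg_circle (Z : Type) (F : set_system Z) (h : Z -> TT) (a : TT) :
  Filter F -> circle_val (h z) @[z --> F] --> circle_val a -> h @ F --> a.
Proof. by move=> FF; exact: cvg_set_val. Qed.

Lemma circleM_cvg (Z : Type) (F : set_system Z) (f g : Z -> TT) (a b : TT) :
  Filter F -> f @ F --> a -> g @ F --> b ->
  circleM (f z) (g z) @[z --> F] --> circleM a b.
Proof.
move=> FF fa gb; apply: cvg_circle.
have fa' := cvg_cts FF circle_val_cts fa.
have gb' := cvg_cts FF circle_val_cts gb.
exact: (@cvgM C Z F FF _ _ _ _ fa' gb').
Qed.

Lemma circleC_cvg (Z : Type) (F : set_system Z) (f : Z -> TT) (a : TT) :
  Filter F -> f @ F --> a -> circleC (f z) @[z --> F] --> circleC a.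
Proof.
move=> FF fa; apply: cvg_circle.
exact: (cvg_cts FF conj_cts (cvg_cts FF circle_val_cts fa)).
Qed.

Lemma circleMA (x y z : TT) : circleM x (circleM y z) = circleM (circleM x y) z.
Proof. by apply: circle_val_inj; rewrite !mk_circleK mulrA. Qed.

Lemma circle1M (z : TT) : circleM (circle1 R) z = z.
Proof. by apply: circle_val_inj; rewrite !mk_circleK mul1r. Qed.

Lemma circleM1 (z : TT) : circleM z (circle1 R) = z.
Proof. by rewrite circleMC circle1M. Qed.

Lemma circleCl (z : TT) : circleM (circleC z) z = circle1 R.
Proof. by rewrite circleMC circleCr. Qed.

Lemma real_complex_cts : continuous (fun x : R => x%:C%C : C).
Proof.
move=> x; apply/(@cvgrPdist_lt C C^o) => e e0.
have [re0 ie0] : 0 < complex.Re e /\ complex.Im e = 0.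
  by move: e0; rewrite ltcE /= => /andP[/eqP].
have xx : (fun w : R => w) @ nbhs x --> x by [].
move/cvgrPdist_lt : xx => /(_ _ re0); apply: filterS => w.
rewrite -raddfB /= normc_def /= expr0n addr0 sqrtr_sqr => h.
by rewrite ltcE /= ie0 eqxx h.
Qed.

(** The circle is closed, and contained in the image of the square [-1, 1]^2
    under (x, y) |-> x + iy. *)
Lemma circle_set_compact : compact (@circle_set R).
Proof.
pose f (p : R * R) : C := (p.1)%:C%C + 'i%C * (p.2)%:C%C.
have cf : continuous f.
  move=> p; apply: cvgD.
    exact: (@cvg_cts _ _ _ _ fst _ _ _ real_complex_cts cvg_fst).
  apply: cvgMl_tmp.
  exact: (@cvg_cts _ _ _ _ snd _ _ _ real_complex_cts cvg_snd).
apply: (@subclosed_compact _ _ (f @` (`[-1, 1] `*` `[-1, 1]))).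
- have -> : @circle_set R = [set z : C | `|z| = cst 1 z] by [].
  apply: (@closed_eq C C); first exact: (@norm_hausdorff C C^o).
    exact: norm_continuous.
  exact: cst_continuous.
- apply: continuous_compact; first exact: continuous_subspaceT.
  by apply: compact_setX; exact: segment_compact.
move=> z /= z1; exists (complex.Re z, complex.Im z); last first.
  by rewrite /f /= -complexE.
have : complex.Re z ^+ 2 + complex.Im z ^+ 2 = 1.
  have {}z1 := congr1 (@complex.Re R) (etrans (esym (normc_def z)) z1).
  rewrite /= in z1.
  rewrite -[LHS]sqr_sqrtr ?z1 ?expr1n //.
  by apply: addr_ge0; exact: sqr_ge0.
rewrite /= !in_itv /= => e.
split; apply/andP; nra.
Qed.

Lemma circle_compact : compact [set: TT].
Proof.
rewrite -(preimage_setT (@set_val C (@circle_set R))).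
by apply: compact_set_val; rewrite setTI; exact: circle_set_compact.
Qed.

Lemma circle_lc_hausdorff : lc_hausdorff TT.
Proof.
apply: lc_hausdorffI.
  move=> x y cl; apply: val_inj; apply: (@norm_hausdorff C C^o).
  exact: (@cluster_cvg _ _ _ x y (@circle_val_cts x) (@circle_val_cts y) cl).
by move=> x; exists setT; [exact: filterT|exact: circle_compact].
Qed.

End CircleTopology.

(** * Principal circle bundles *)

Section PrincipalBundles.
Variables (R : realType) (P B : topologicalType) (p : P -> B).
Variable act : circle R -> P -> P.
Local Notation TT := (circle R).

(** The division r' / r of two points of the same fiber. *)
Definition pdiv (r r' : P) : TT := xget (circle1 R) [set z | r' = act z r].

Section Theory.
Hypothesis pP : principal_circle_bundle p act.

(** Every trivialization amounts to a continuous section [s] over an open [U]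
    together with the continuous function [k] measuring the position of a
    point relatively to [s]; this form is the one that is easy to transport. *)
Lemma pcb_local b : exists (U : set B) (s : B -> P) (k : P -> TT),
  [/\ open U, U b,
      (forall c, U c -> p (s c) = c /\ s @ nbhs c --> s c),
      (forall r, U (p r) -> k @ nbhs r --> k r /\ r = act (k r) (s (p r))) &
      (forall c z, U c -> k (act z (s c)) = z)].
Proof.
have [U [phi [psi [oU Ub [fU gU fK gK cf cg] pphi actphi]]]] :=
  pcb_loc_triv pP b.
have phiE c z : U c -> act z (phi (c, circle1 R)) = phi (c, z).
  by move=> Uc; rewrite -actphi // circleM1.
have psiE r : U (p r) -> r = act (psi r).2 (phi (p r, circle1 R)).
  move=> Ur; have [Upsi _] := gU r Ur; have e := gK r (mem_set Ur).
  have <- : (psi r).1 = p r.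
    by rewrite -[LHS](pphi _ (psi r).2) // -surjective_pairing e.
  by rewrite phiE // -surjective_pairing e.
exists U, (fun c => phi (c, circle1 R)), (fun r => (psi r).2); split=> //.
- move=> c Uc; split; first exact: pphi.
  apply: (@cvg_within_comp _ _ _ _ phi (fun c => (c, circle1 R)) _ (c, circle1 R)
    _ cf); first by split.
    by apply: cvg_prod; [exact: cvg_id|exact: cvg_cst].
  have : \forall z \near c, U z by exact: open_nbhs_nbhs.
  by apply: filterS => z Uz; split.
- move=> r Ur; split; last exact: psiE.
  have cpsi : psi @ nbhs r --> psi r.
    apply: (@cvg_within_comp _ _ _ _ psi id _ r _ cg) => //.
    by have h := cvg_open (pcb_cts pP (x := r)) oU Ur; exact: h.
  exact: (@cvg_comp _ _ _ psi snd _ _ _ cpsi cvg_snd).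
- by move=> c z Uc; rewrite phiE // fK //; apply: mem_set; split.
Qed.

Lemma pcb_free z w r : act z r = act w r -> z = w.
Proof.
have [U [s [k [_ Ub _ kP ks]]]] := pcb_local (p r).
have [_ ->] := kP r Ub; rewrite -!(pcb_actM pP) => /(congr1 k).
rewrite !ks // => /(congr1 (fun u => circleM u (circleC (k r)))).
by rewrite -!circleMA circleCr !circleM1.
Qed.

Lemma pcb_surj b : exists r, p r = b.
Proof.
have [U [s [k [_ Ub sP _ _]]]] := pcb_local b.
by exists (s b); apply: (sP b Ub).1.
Qed.

Lemma pcb_act_cvg (Z : Type) (F : set_system Z) (f : Z -> TT) (g : Z -> P) z r :
  Filter F -> f @ F --> z -> g @ F --> r ->
  act (f x) (g x) @[x --> F] --> act z r.
Proof.
move=> FF fz gr; have := @pcb_act_cts _ _ _ _ _ pP (z, r).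
by apply: (@cvg_comp _ _ _ (fun x => (f x, g x))); exact: cvg_prod.
Qed.

Lemma pdivK r r' : p r = p r' -> act (pdiv r r') r = r'.
Proof.
move=> rr'; suff : [set z | r' = act z r] (pdiv r r') by move=> /= <-.
have [U [s [k [_ Ub _ kP _]]]] := pcb_local (p r).
have [_ er] := kP r Ub; have := kP r'; rewrite -rr' => /(_ Ub) [_ er'].
apply: (@xgetPex _ (circle1 R) [set z | r' = act z r]).
exists (circleM (k r') (circleC (k r))); rewrite /= {2}er -(pcb_actM pP).
by rewrite -circleMA circleCl circleM1.
Qed.

Lemma pdiv_act z r : pdiv r (act z r) = z.
Proof.
by apply: (@pcb_free _ _ r); rewrite pdivK // (pcb_act_fiber pP).
Qed.

Lemma pdivE z r r' : act z r = r' -> pdiv r r' = z.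
Proof. by move<-; rewrite pdiv_act. Qed.

(** In a local trivialization, division is the quotient of the positions. *)
Lemma pdiv_cts :
  {within [set q | p q.1 = p q.2], continuous (fun q => pdiv q.1 q.2)}.
Proof.
apply/subspace_continuousP => -[r r'] /= rr'.
have [U [s [k [oU Ub _ kP _]]]] := pcb_local (p r).
have Ub' : U (p r') by rewrite -rr'.
have pdE q : p q.1 = p q.2 -> U (p q.1) ->
    pdiv q.1 q.2 = circleM (k q.2) (circleC (k q.1)).
  move=> e Uq; apply: pdivE; have [_ e1] := kP _ Uq; rewrite {2}e1.
  rewrite -(pcb_actM pP) -circleMA circleCl circleM1 e.
  by rewrite e in Uq; have [_ <-] := kP _ Uq.
pose A := [set q : P * P | p q.1 = p q.2].
have c1 : fst @ within A (nbhs (r, r')) --> r by exact: cvg_fst_within.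
have c2 : snd @ within A (nbhs (r, r')) --> r' by exact: cvg_snd_within.
have /= e := pdE (r, r') rr' Ub; rewrite /from_subspace /= e.
apply: (@cvg_near_eq _ _ _ (fun q => circleM (k q.2) (circleC (k q.1)))).
  have nU : \forall q \near within A (nbhs (r, r')), U (p q.1).
    exact: (cvg_open (cvg_cts _ (pcb_cts pP) c1) oU Ub).
  by apply: (filterS2 _ _ (near_withinA A (r, r')) nU) => q; exact: pdE.
apply: circleM_cvg; last apply: circleC_cvg.
  by apply: cvg_comp c2 _; exact: (kP r' Ub').1.
by apply: cvg_comp c1 _; exact: (kP r Ub).1.
Qed.

Lemma pdiv_cvg (Z : Type) (F : set_system Z) (f g : Z -> P) r r' :
  Filter F -> f @ F --> r -> g @ F --> r' -> p r = p r' ->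
  (\forall x \near F, p (f x) = p (g x)) ->
  pdiv (f x) (g x) @[x --> F] --> pdiv r r'.
Proof.
move=> FF fr gr rr' nfg.
apply: (@cvg_within_comp _ _ _ _ (fun q => pdiv q.1 q.2) (fun x => (f x, g x))
  _ (r, r') _ pdiv_cts) => //; exact: cvg_prod.
Qed.

(** Points in different fibers are separated by the base, points in the same
    fiber by their positions in a trivialization; the circle being compact, the
    part of the bundle over a small compact set is compact. *)
Lemma pcb_lc_hausdorff : lc_hausdorff B -> lc_hausdorff P.
Proof.
move=> lB; have [hB _] := lB; have [hT _] := circle_lc_hausdorff R.
have hP : hausdorff_space P.
  move=> r r' cl.
  have rr' : p r = p r'.
    apply: hB.
    exact: (cluster_cvg (pcb_cts pP (x := r)) (pcb_cts pP (x := r')) cl).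
  have [U [s [k [oU Ub _ kP _]]]] := pcb_local (p r).
  have Ub' : U (p r') by rewrite -rr'.
  have [c er] := kP r Ub; have [c' er'] := kP r' Ub'.
  rewrite er er' rr'; congr act; apply: hT; exact: (cluster_cvg _ _ cl).
apply: lc_hausdorffI => // r.
have [U [s [k [oU Ub sP kP _]]]] := pcb_local (p r).
have Un : nbhs (p r) U by exact: open_nbhs_nbhs.
have [K [nK cK KU]] := lc_hausdorff_small lB Un.
exists ((fun q => act q.1 (s q.2)) @` (setT `*` K)).
  have nK' : nbhs r (p @^-1` K) := pcb_cts pP nK.
  apply: filterS nK' => x Kx.
  by exists (k x, p x) => //=; rewrite -(kP x (KU _ Kx)).2.
apply: continuous_compact; last first.
  apply: compact_setX => //.
  exact: circle_compact.
apply/subspace_continuousP => -[z b] [_ Kb].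
apply: pcb_act_cvg; first exact: cvg_fst_within.
by apply: (cvg_at_comp _ (sP b (KU _ Kb)).2); exact: cvg_snd_within.
Qed.

End Theory.

(** Conversely, local sections and a continuous division are all that a
    principal bundle structure requires. *)
Lemma pcb_intro (d : P -> P -> TT) :
  continuous p -> continuous (fun q : TT * P => act q.1 q.2) ->
  (forall r, act (circle1 R) r = r) ->
  (forall z w r, act (circleM z w) r = act z (act w r)) ->
  (forall z r, p (act z r) = p r) ->
  (forall b, exists (U : set B) (s : B -> P), [/\ open U, U b &
     forall c, U c -> p (s c) = c /\ s @ nbhs c --> s c]) ->
  (forall r r', p r = p r' -> act (d r r') r = r') ->
  (forall z r, d r (act z r) = z) ->
  {within [set q | p q.1 = p q.2], continuous (fun q => d q.1 q.2)} ->
  principal_circle_bundle p act.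
Proof.
move=> cp ca a1 aM ap ls dK dE cd; split=> // b.
have [U [s [oU Ub sP]]] := ls b.
exists U, (fun q => act q.2 (s q.1)), (fun r => (p r, d (s (p r)) r)).
split=> //; [split| |].
- by move=> [c z] [/= Uc _]; rewrite /preimage /= ap (sP c Uc).1.
- by move=> r Ur; split.
- move=> [c z] /set_mem [/= Uc _]; have e : p (act z (s c)) = c.
    by rewrite ap (sP c Uc).1.
  by rewrite e dE.
- by move=> r /set_mem Ur /=; rewrite dK // (sP _ Ur).1.
- apply/subspace_continuousP => -[c z] [/= Uc _].
  apply: (@cvg_comp _ _ _ (fun q : B * TT => (q.2, s q.1)) (fun q => act q.1 q.2)
    _ (nbhs (z, s c))); last exact: (ca (z, s c)).
  apply: cvg_prod; first exact: cvg_snd_within.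
  by apply: (cvg_at_comp _ (sP c Uc).2); exact: cvg_fst_within.
- apply/subspace_continuousP => r Ur.
  have pr : p @ within (p @^-1` U) (nbhs r) --> p r.
    by apply: cvg_within_filter; exact: cp.
  apply: cvg_prod => //.
  apply: (@cvg_within_comp _ _ _ _ (fun q => d q.1 q.2) (fun r => (s (p r), r))
    _ (s (p r), r) _ cd).
  + by rewrite /= (sP _ Ur).1.
  + apply: cvg_prod; last exact: cvg_within.
    by apply: cvg_comp pr _; exact: (sP _ Ur).2.
  + by apply: filterS (near_withinA _ r) => r' Ur' /=; rewrite (sP _ Ur').1.
- by move=> c z Uc /=; rewrite ap (sP c Uc).1.
- by move=> c z w Uc /=.
Qed.

End PrincipalBundles.

(** Equivariant maps of principal bundles over the same base are
    homeomorphisms, because they preserve division. *)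
Lemma pcb_morphism_homeo (R : realType) (P P' B : topologicalType)
    (p : P -> B) (p' : P' -> B) act act' (f : P -> P') :
  principal_circle_bundle (R := R) p act ->
  principal_circle_bundle (R := R) p' act' ->
  continuous f -> (forall r, p' (f r) = p r) ->
  (forall z r, f (act z r) = act' z (f r)) ->
  exists g, homeo_on setT setT f g.
Proof.
move=> pP pP' cf fp fa.
pose s b := projT1 (cid (pcb_surj pP b)).
have sP b : p (s b) = b by rewrite /s; case: cid.
(* If [r] lies over the image of [t], then f^-1 t = (t / f r) r. *)
pose g t := act (pdiv act' (f (s (p' t))) t) (s (p' t)).
have gE r t : p r = p' t -> g t = act (pdiv act' (f r) t) r.
  move=> rt; have e := sP (p' t); rewrite /g.
  have [z <-] : exists z, act z r = s (p' t).
    by exists (pdiv act r (s (p' t))); rewrite (pdivK pP) // e.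
  rewrite -(pcb_actM pP); congr act.
  apply: esym; apply: (pdivE pP').
  by rewrite (pcb_actM pP') -fa (pdivK pP') // fp (pcb_act_fiber pP).
have fK : cancel f g.
  move=> r; rewrite (gE r) ?fp //.
  by rewrite (pdivE pP' (pcb_act1 pP' (f r))) (pcb_act1 pP).
have gK : cancel g f.
  by move=> t; rewrite /g fa (pdivK pP') // fp sP.
exists g; split; [by []|by []| | | |].
- by move=> x _; rewrite fK.
- by move=> x _; rewrite gK.
- exact: continuous_subspaceT.
apply: continuous_subspaceT => t.
have [U [sg [k [oU Ub sgP _ _]]]] := pcb_local pP (p' t).
have cp' := @pcb_cts _ _ _ _ _ pP' t.
have nU : \forall t' \near t, U (p' t') by exact: (cvg_open cp' oU Ub).
have csg : sg (p' t') @[t' --> t] --> sg (p' t).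
  by apply: cvg_comp cp' _; exact: (sgP _ Ub).2.
rewrite /continuous_at (gE (sg (p' t))) ?(sgP _ Ub).1 //.
apply: (@cvg_near_eq _ _ _
  (fun t' => act (pdiv act' (f (sg (p' t'))) t') (sg (p' t')))).
  by apply: filterS nU => t' Ut'; rewrite (gE (sg (p' t'))) // (sgP _ Ut').1.
apply: (pcb_act_cvg pP) => //.
apply: (pdiv_cvg pP') => //.
- by apply: cvg_comp csg _; exact: cf.
- by rewrite fp (sgP _ Ub).1.
- by apply: filterS nU => t' Ut'; rewrite fp (sgP _ Ut').1.
Qed.

(** * Twists and their isomorphisms *)

Section GroupoidAlgebra.
Variables (X : topologicalType) (G : groupoid_data X).
Hypothesis hG : is_groupoid G.

Lemma gmul_inv_uniq (g h : G) :
  src g = rng h -> gmul g h = unit_at G (rng g) -> h = ginv g.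
Proof.
move=> gh e; rewrite -(gmul1l hG h) -gh -(gmulVl hG) -(gmulA hG) ?src_inv //.
by rewrite e -(src_inv hG g) gmul1r.
Qed.

Lemma gmul_idem (g : G) x : src g = x -> rng g = x -> gmul g g = g ->
  g = unit_at G x.
Proof.
move=> sg rg e; rewrite -sg -(gmulVl hG) -{3}e.
by rewrite (gmulA hG) ?src_inv ?sg ?rg // (gmulVl hG) sg -rg gmul1l.
Qed.

End GroupoidAlgebra.

Section TwistIsomorphisms.
Variables (R : realType) (X : topologicalType) (G : groupoid_data X).
Implicit Types S T U : twist_data R G.

Lemma twist_iso_refl T : twist_iso T T.
Proof.
exists id, id; split=> //.
by split=> //; apply: continuous_subspaceT => x; exact: cvg_id.
Qed.

Lemma twist_iso_sym S T : twist_iso S T -> twist_iso T S.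
Proof.
move=> [f [g [[_ _ fK gK cf cg] hf fpi fact]]].
have {}fK r : g (f r) = r by apply: fK; rewrite in_setT.
have {}gK r : f (g r) = r by apply: gK; rewrite in_setT.
have fI : injective f by exact: can_inj fK.
exists g, f; split.
- by split=> // r _; rewrite ?gK ?fK.
- have gs r : src (g r) = src r by rewrite -(hom_src hf) gK.
  have gr r : rng (g r) = rng r by rewrite -(hom_rng hf) gK.
  split=> //; first by move=> x; rewrite -(hom_unit hf) fK.
  by move=> r s rs; apply: fI; rewrite (hom_mul hf) ?gK // gs gr.
- by move=> r; rewrite -fpi gK.
- by move=> z r; apply: fI; rewrite fact !gK.
Qed.

Lemma twist_iso_trans S T U : twist_iso S T -> twist_iso T U -> twist_iso S U.
Proof.
move=> [f [g [[_ _ fK gK cf cg] hf fpi fact]]].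
move=> [f' [g' [[_ _ fK' gK' cf' cg'] hf' fpi' fact']]].
exists (f' \o f), (g \o g'); split.
- split=> //.
  + by move=> r rT /=; rewrite fK' ?in_setT // fK.
  + by move=> r rT /=; rewrite gK ?in_setT // gK'.
  + exact: (within_comp cf' cf).
  + exact: (within_comp cg cg').
- split=> /=.
  + by move=> r; rewrite (hom_src hf') (hom_src hf).
  + by move=> r; rewrite (hom_rng hf') (hom_rng hf).
  + by move=> x; rewrite (hom_unit hf) (hom_unit hf').
  + move=> r s rs; rewrite (hom_mul hf) // (hom_mul hf') //.
    by rewrite (hom_src hf) (hom_rng hf).
- by move=> r /=; rewrite fpi' fpi.
- by move=> z r /=; rewrite fact fact'.
Qed.

(** A morphism of twists is an isomorphism: continuity of its inverse comes
    from the bundle structure, and compatibility with units from the fact that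
    units are the idempotents of a groupoid. *)
Lemma twist_morphism_iso S T (f : S -> T) :
  is_twist S -> is_twist T -> continuous f ->
  (forall r, tw_pi (f r) = tw_pi r) ->
  (forall z r, f (tw_act z r) = tw_act z (f r)) ->
  (forall r s, src r = rng s -> f (gmul r s) = gmul (f r) (f s)) ->
  twist_iso S T.
Proof.
move=> hS hT cf fpi fact fM.
have [g hg] := pcb_morphism_homeo (tw_bundle hS) (tw_bundle hT) cf fpi fact.
have fs r : src (f r) = src r.
  by rewrite -(hom_src (tw_hom hT)) fpi (hom_src (tw_hom hS)).
have fr r : rng (f r) = rng r.
  by rewrite -(hom_rng (tw_hom hT)) fpi (hom_rng (tw_hom hS)).
have gS := lch_is_groupoid (tw_lch hS).
exists f, g; split=> //; split=> // x.
apply: (gmul_idem (lch_is_groupoid (tw_lch hT))).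
- by rewrite fs (src_unit gS).
- by rewrite fr (rng_unit gS).
- rewrite -fM ?(src_unit gS) ?(rng_unit gS) //.
  by congr f; have := gmul1l gS (unit_at S x); rewrite (rng_unit gS).
Qed.

(** The source and range maps of a twist factor through its base, so the
    topological conditions on a twist reduce to its bundle structure and to the
    continuity of the algebraic operations. *)
Lemma twist_intro T : lch_groupoid G -> is_groupoid T ->
  groupoid_hom (@tw_pi _ _ _ T) ->
  principal_circle_bundle (@tw_pi _ _ _ T) (@tw_act _ _ _ T) ->
  (forall z1 z2 (r1 r2 : T), src r1 = rng r2 ->
    gmul (tw_act z1 r1) (tw_act z2 r2) = tw_act (circleM z1 z2) (gmul r1 r2)) ->
  continuous (@unit_at _ T) -> continuous (@ginv _ T) ->
  {within composable (G := T), continuous (fun p => gmul p.1 p.2)} ->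
  is_twist T.
Proof.
move=> hG gT hpi pT compat cu ci cm.
have lT : lc_hausdorff T := pcb_lc_hausdorff pT (lch_arrows hG).
have cs : continuous (@src _ T).
  have -> : @src _ T = (@src _ G) \o (@tw_pi _ _ _ T).
    by apply/funext => r /=; rewrite (hom_src hpi).
  by move=> r; apply: continuous_comp; [exact: pcb_cts pT r|exact: src_cts].
have cr : continuous (@rng _ T).
  have -> : @rng _ T = (@rng _ G) \o (@tw_pi _ _ _ T).
    by apply/funext => r /=; rewrite (hom_rng hpi).
  by move=> r; apply: continuous_comp; [exact: pcb_cts pT r|exact: rng_cts].
split=> //; split=> //; first exact: lch_unit_space hG.
apply: lc_hausdorff_closed; first exact: lc_hausdorff_prod.
have [hX _] := lch_unit_space hG.
apply: (@closed_eq (T * T)%type X (fun p => src p.1) (fun p => rng p.2)) => //.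
  by move=> p; apply: (cvg_cts _ cs); exact: cvg_fst.
by move=> p; apply: (cvg_cts _ cr); exact: cvg_snd.
Qed.

Section Operations.
Variable T : twist_data R G.
Hypothesis hT : is_twist T.
Local Notation TT := (circle R).
Let gT := lch_is_groupoid (tw_lch hT).
Let bT := tw_bundle hT.

Lemma src_act z (r : T) : src (tw_act z r) = src r.
Proof. by rewrite -!(hom_src (tw_hom hT)) (pcb_act_fiber bT). Qed.

Lemma rng_act z (r : T) : rng (tw_act z r) = rng r.
Proof. by rewrite -!(hom_rng (tw_hom hT)) (pcb_act_fiber bT). Qed.

Lemma ginv_act z (r : T) : ginv (tw_act z r) = tw_act (circleC z) (ginv r).
Proof.
apply/esym/(gmul_inv_uniq gT).
  by rewrite src_act rng_act rng_inv.
by rewrite (tw_compat hT) ?rng_inv // circleCr (pcb_act1 bT) rng_act gmulV.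
Qed.

Lemma pi_ginv (r : T) : is_groupoid G -> tw_pi (ginv r) = ginv (tw_pi r).
Proof.
move=> gG; apply: (gmul_inv_uniq gG).
  by rewrite (hom_src (tw_hom hT)) (hom_rng (tw_hom hT)) rng_inv.
rewrite -(hom_mul (tw_hom hT)) ?rng_inv // gmulV // (hom_unit (tw_hom hT)).
by rewrite (hom_rng (tw_hom hT)).
Qed.

Lemma gmul_cvg (Z : Type) (F : set_system Z) (f g : Z -> T) (r s : T) :
  Filter F -> f @ F --> r -> g @ F --> s -> src r = rng s ->
  (\forall x \near F, src (f x) = rng (g x)) ->
  gmul (f x) (g x) @[x --> F] --> gmul r s.
Proof.
move=> FF fr gs rs nfg.
apply: (@cvg_within_comp _ _ _ _ (fun q : T * T => gmul q.1 q.2)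
  (fun x => (f x, g x)) _ (r, s) _ (gmul_cts (tw_lch hT))) => //.
exact: cvg_prod.
Qed.

End Operations.

End TwistIsomorphisms.

(** * The Baer sum of two twists *)

Section BaerSumTwist.
Variables (R : realType) (X : topologicalType) (G : groupoid_data X).
Hypothesis hG : lch_groupoid G.
Variables T1 T2 : twist R G.
Local Notation TT := (circle R).
Local Notation B := (baer_space T1 T2).
Local Notation S := (baer_sum T1 T2).
Local Notation FP := (fiber_prod_space T1 T2).

Let gG := lch_is_groupoid hG.
Let h1 := twistP T1.
Let h2 := twistP T2.
Let g1 := lch_is_groupoid (tw_lch h1).
Let g2 := lch_is_groupoid (tw_lch h2).
Let b1 := tw_bundle h1.
Let b2 := tw_bundle h2.

(** The structure of the Baer sum is defined through representatives chosen by
    [repr].  The lemmas below express it on classes [bclass r1 r2] of arbitrary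
    pairs with [tw_pi r1 = tw_pi r2], so that [repr] can be forgotten. *)
Definition bclass (r1 : T1) (r2 : T2) : S :=
  baer_class (baer_unit T1 T2 (src r1)) r1 r2.

Lemma fp_pi (p : FP) : tw_pi (fp1 p) = tw_pi (fp2 p).
Proof. exact: (set_valP p). Qed.

Lemma baer_classE (x : B) (r1 : T1) (r2 : T2) :
  tw_pi r1 = tw_pi r2 -> baer_class x r1 r2 = bclass r1 r2.
Proof.
move=> e; rewrite /bclass /baer_class; congr (\pi_B _).
have m : (r1, r2) \in @fiber_prod _ _ _ T1 T2 by apply: mem_set.
by apply: val_inj; rewrite !insubdK.
Qed.

Lemma pi_bclass (p : FP) : \pi_B p = bclass (fp1 p) (fp2 p).
Proof.
rewrite -(baer_classE (\pi_B p) (fp_pi p)) /baer_class; congr (\pi_B _).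
apply: val_inj; rewrite insubdK; first by rewrite /fp1 /fp2 -surjective_pairing.
exact: (valP p).
Qed.

Lemma fp_mk (r1 : T1) (r2 : T2) : tw_pi r1 = tw_pi r2 ->
  exists p : FP, fp1 p = r1 /\ fp2 p = r2.
Proof.
move=> e; have m : (r1, r2) \in @fiber_prod _ _ _ T1 T2 by apply: mem_set.
by exists (SigSub m : FP).
Qed.

Lemma bclassP (x : S) :
  exists r1 r2, tw_pi r1 = tw_pi r2 /\ x = bclass r1 r2.
Proof.
exists (fp1 (repr x)), (fp2 (repr x)); split; first exact: fp_pi.
by rewrite -pi_bclass reprK.
Qed.

Lemma bclass_eqP (r1 s1 : T1) (r2 s2 : T2) :
  tw_pi r1 = tw_pi r2 -> tw_pi s1 = tw_pi s2 ->
  bclass r1 r2 = bclass s1 s2 <->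
  exists z : TT, s1 = tw_act z r1 /\ s2 = tw_act (circleC z) r2.
Proof.
move=> /fp_mk[p [<- <-]] /fp_mk[q [<- <-]]; rewrite -!pi_bclass; split.
  by move=> /eqmodP/asboolP.
by move=> h; apply/eqmodP/asboolP.
Qed.

Lemma repr_bclass (r1 : T1) (r2 : T2) : tw_pi r1 = tw_pi r2 ->
  exists z : TT, fp1 (repr (bclass r1 r2 : B)) = tw_act z r1 /\
                 fp2 (repr (bclass r1 r2 : B)) = tw_act (circleC z) r2.
Proof.
move=> e; apply/bclass_eqP => //; first exact: fp_pi.
by rewrite -pi_bclass reprK.
Qed.

Lemma bclass_act z (r1 : T1) (r2 : T2) : tw_pi r1 = tw_pi r2 ->
  bclass (tw_act z r1) r2 = bclass r1 (tw_act z r2).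
Proof.
move=> e; apply/bclass_eqP; rewrite ?(pcb_act_fiber b1) ?(pcb_act_fiber b2) //.
exists (circleC z); rewrite -(pcb_actM b1) circleCl (pcb_act1 b1).
by rewrite circleCK.
Qed.

Lemma src_bclass (r1 : T1) (r2 : T2) : tw_pi r1 = tw_pi r2 ->
  src (bclass r1 r2) = src r1.
Proof. by move=> /repr_bclass[z [e _]]; rewrite /= e (src_act h1). Qed.

Lemma rng_bclass (r1 : T1) (r2 : T2) : tw_pi r1 = tw_pi r2 ->
  rng (bclass r1 r2) = rng r1.
Proof. by move=> /repr_bclass[z [e _]]; rewrite /= e (rng_act h1). Qed.

Lemma tw_pi_bclass (r1 : T1) (r2 : T2) : tw_pi r1 = tw_pi r2 ->
  tw_pi (bclass r1 r2 : S) = tw_pi r1.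
Proof. by move=> /repr_bclass[z [e _]]; rewrite /= e (pcb_act_fiber b1). Qed.

Lemma tw_pi_pi (p : FP) : tw_pi (\pi_B p : S) = tw_pi (fp1 p).
Proof. by rewrite pi_bclass tw_pi_bclass ?fp_pi. Qed.

Lemma src_pi (p : FP) : src (\pi_B p : S) = src (fp1 p).
Proof. by rewrite pi_bclass src_bclass ?fp_pi. Qed.

Lemma rng_pi (p : FP) : rng (\pi_B p : S) = rng (fp1 p).
Proof. by rewrite pi_bclass rng_bclass ?fp_pi. Qed.

Lemma unit_bclass x : unit_at S x = bclass (unit_at T1 x) (unit_at T2 x).
Proof. exact: pi_bclass. Qed.

Lemma tw_act_bclass z (r1 : T1) (r2 : T2) : tw_pi r1 = tw_pi r2 ->
  tw_act z (bclass r1 r2 : S) = bclass (tw_act z r1) r2.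
Proof.
move=> e; have [w [e1 e2]] := repr_bclass e.
rewrite [LHS]baer_classE ?(pcb_act_fiber b1) ?fp_pi // e1 e2.
rewrite -(pcb_actM b1) -bclass_act ?(pcb_act_fiber b1) // -(pcb_actM b1).
by rewrite circleMC -circleMA circleCr circleM1.
Qed.

Lemma bclass_src_rng (r1 s1 : T1) (r2 s2 : T2) : tw_pi r1 = tw_pi r2 ->
  tw_pi s1 = tw_pi s2 -> src r1 = rng s1 -> src r2 = rng s2.
Proof.
move=> e e' rs; rewrite -(hom_src (tw_hom h2)) -e (hom_src (tw_hom h1)) rs.
by rewrite -(hom_rng (tw_hom h1)) e' (hom_rng (tw_hom h2)).
Qed.

Lemma pi_gmul (r1 s1 : T1) (r2 s2 : T2) : tw_pi r1 = tw_pi r2 ->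
  tw_pi s1 = tw_pi s2 -> src r1 = rng s1 ->
  tw_pi (gmul r1 s1) = tw_pi (gmul r2 s2).
Proof.
move=> e e' rs; rewrite (hom_mul (tw_hom h1)) // (hom_mul (tw_hom h2)).
  by rewrite e e'.
exact: (bclass_src_rng e e').
Qed.

Lemma gmul_bclass (r1 s1 : T1) (r2 s2 : T2) :
  tw_pi r1 = tw_pi r2 -> tw_pi s1 = tw_pi s2 ->
  src r1 = rng s1 ->
  gmul (bclass r1 r2) (bclass s1 s2) = bclass (gmul r1 s1) (gmul r2 s2).
Proof.
move=> e e' rs; have rs2 := bclass_src_rng e e' rs.
have [w [e1 e2]] := repr_bclass e; have [w' [e1' e2']] := repr_bclass e'.
have E := pi_gmul e e' rs.
rewrite [LHS]/= e1 e2 e1' e2' (tw_compat h1) // (tw_compat h2) //.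
rewrite baer_classE ?(pcb_act_fiber b1) ?(pcb_act_fiber b2) //.
rewrite bclass_act ?(pcb_act_fiber b2) // -(pcb_actM b2) -circleCM circleCr.
by rewrite (pcb_act1 b2).
Qed.

Lemma ginv_bclass (r1 : T1) (r2 : T2) : tw_pi r1 = tw_pi r2 ->
  ginv (bclass r1 r2) = bclass (ginv r1) (ginv r2).
Proof.
move=> e; have [w [e1 e2]] := repr_bclass e.
have E : tw_pi (ginv r1) = tw_pi (ginv r2).
  by rewrite (pi_ginv h1) // (pi_ginv h2) // e.
rewrite [LHS]/= e1 e2 (ginv_act h1) (ginv_act h2).
rewrite baer_classE ?(pcb_act_fiber b1) ?(pcb_act_fiber b2) //.
rewrite bclass_act ?(pcb_act_fiber b2) // -(pcb_actM b2) circleCK circleCl.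
by rewrite (pcb_act1 b2).
Qed.

Lemma baer_is_groupoid : is_groupoid S.
Proof.
have eu x : tw_pi (unit_at T1 x) = tw_pi (unit_at T2 x).
  by rewrite (hom_unit (tw_hom h1)) (hom_unit (tw_hom h2)).
have ei (r1 : T1) (r2 : T2) :
      tw_pi r1 = tw_pi r2 -> tw_pi (ginv r1) = tw_pi (ginv r2).
  by move=> e; rewrite (pi_ginv h1) // (pi_ginv h2) // e.
have es (r1 : T1) (r2 : T2) : tw_pi r1 = tw_pi r2 -> src r2 = src r1.
  by move=> e; rewrite -(hom_src (tw_hom h2)) -e (hom_src (tw_hom h1)).
have er (r1 : T1) (r2 : T2) : tw_pi r1 = tw_pi r2 -> rng r2 = rng r1.
  by move=> e; rewrite -(hom_rng (tw_hom h2)) -e (hom_rng (tw_hom h1)).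
split.
- by move=> x; rewrite unit_bclass src_bclass // (src_unit g1).
- by move=> x; rewrite unit_bclass rng_bclass // (rng_unit g1).
- move=> x y; have [r1 [r2 [e ->]]] := bclassP x.
  have [s1 [s2 [e' ->]]] := bclassP y; rewrite !src_bclass // rng_bclass // => rs.
  rewrite gmul_bclass // src_bclass; last exact: pi_gmul.
  exact: (src_mul g1).
- move=> x y; have [r1 [r2 [e ->]]] := bclassP x.
  have [s1 [s2 [e' ->]]] := bclassP y; rewrite src_bclass // !rng_bclass // => rs.
  rewrite gmul_bclass // rng_bclass; last exact: pi_gmul.
  exact: (rng_mul g1).
- move=> x y z; have [r1 [r2 [e ->]]] := bclassP x.
  have [s1 [s2 [e' ->]]] := bclassP y; have [t1 [t2 [e'' ->]]] := bclassP z.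
  rewrite !src_bclass // !rng_bclass // => rs st.
  have rs2 := bclass_src_rng e e' rs; have st2 := bclass_src_rng e' e'' st.
  have E := pi_gmul e e' rs; have E' := pi_gmul e' e'' st.
  rewrite !gmul_bclass // ?(rng_mul g1) ?(src_mul g1) //.
  by rewrite (gmulA g1) // (gmulA g2).
- move=> x; have [r1 [r2 [e ->]]] := bclassP x.
  rewrite unit_bclass rng_bclass // gmul_bclass ?(src_unit g1) //.
  by rewrite (gmul1l g1) -(er _ _ e) (gmul1l g2).
- move=> x; have [r1 [r2 [e ->]]] := bclassP x.
  rewrite unit_bclass src_bclass // gmul_bclass ?(rng_unit g1) //.
  by rewrite (gmul1r g1) -(es _ _ e) (gmul1r g2).
- move=> x; have [r1 [r2 [e ->]]] := bclassP x.
  rewrite ginv_bclass // src_bclass; last exact: ei.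
  by rewrite rng_bclass // (src_inv g1).
- move=> x; have [r1 [r2 [e ->]]] := bclassP x.
  rewrite ginv_bclass // rng_bclass; last exact: ei.
  by rewrite src_bclass // (rng_inv g1).
- move=> x; have [r1 [r2 [e ->]]] := bclassP x; have e' := ei _ _ e.
  rewrite ginv_bclass // unit_bclass rng_bclass // gmul_bclass ?(rng_inv g1) //.
  by rewrite (gmulV g1) (gmulV g2) (er _ _ e).
- move=> x; have [r1 [r2 [e ->]]] := bclassP x; have e' := ei _ _ e.
  rewrite ginv_bclass // unit_bclass src_bclass // gmul_bclass ?(src_inv g1) //.
  by rewrite (gmulVl g1) (gmulVl g2) (es _ _ e).
Qed.

Lemma bclass_cvg (Z : Type) (F : set_system Z) (f1 : Z -> T1) (f2 : Z -> T2)
    (r1 : T1) (r2 : T2) :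
  Filter F -> f1 @ F --> r1 -> f2 @ F --> r2 -> tw_pi r1 = tw_pi r2 ->
  (\forall x \near F, tw_pi (f1 x) = tw_pi (f2 x)) ->
  bclass (f1 x) (f2 x) @[x --> F] --> bclass r1 r2.
Proof.
move=> FF fr1 fr2 e nf; have [p [e1 e2]] := fp_mk e.
pose h x : FP := insubd p (f1 x, f2 x).
have hE x : tw_pi (f1 x) = tw_pi (f2 x) -> set_val (h x) = (f1 x, f2 x).
  by move=> ex; apply: insubdK; apply: mem_set.
apply: (@cvg_near_eq _ _ _ (fun x => \pi_B (h x))).
  apply: filterS nf => x ex; rewrite pi_bclass /fp1 /fp2.
  by rewrite (hE x ex).
rewrite -e1 -e2 -pi_bclass; apply: cvg_cts; first exact: pi_continuous.
apply: cvg_set_val; have -> : set_val p = (r1, r2).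
  by rewrite -e1 -e2 /fp1 /fp2 -surjective_pairing.
apply: (@cvg_near_eq _ _ _ (fun x => (f1 x, f2 x))); last exact: cvg_prod.
by apply: filterS nf => x; exact: hE.
Qed.

Lemma bclass_cts (Y : topologicalType) (f1 : Y -> T1) (f2 : Y -> T2) :
  continuous f1 -> continuous f2 -> (forall y, tw_pi (f1 y) = tw_pi (f2 y)) ->
  continuous (fun y => bclass (f1 y) (f2 y)).
Proof.
move=> c1 c2 e y; apply: bclass_cvg; [exact: c1|exact: c2|exact: e|].
by apply: nearW => z; exact: e.
Qed.

Lemma fp1_cts : continuous (@fp1 _ _ _ T1 T2).
Proof.
exact: (cts_comp (@set_val_cts _ (@fiber_prod _ _ _ T1 T2)) (@fst_cts _ _)).
Qed.

Lemma fp2_cts : continuous (@fp2 _ _ _ T1 T2).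
Proof.
exact: (cts_comp (@set_val_cts _ (@fiber_prod _ _ _ T1 T2)) (@snd_cts _ _)).
Qed.

(** The Baer sum is the quotient of the fiber product by a group acting by
    homeomorphisms, hence the projection is open.  Products of open surjections
    are quotient maps, unlike products of general quotient maps: this is what
    makes the multiplication of the Baer sum continuous. *)
Lemma baer_open_map : open_map (\pi_B : FP -> B).
Proof.
apply: open_mapP => U oU.
suff : open (\pi_B @^-1` (\pi_B @` U) : set FP) by [].
(* The saturation of [U] is the union of its translates [A z]. *)
pose A (z : TT) := [set p : FP | exists2 q : FP, U q &
  fp1 q = tw_act z (fp1 p) /\ fp2 q = tw_act (circleC z) (fp2 p)].
have -> : \pi_B @^-1` (\pi_B @` U) = \bigcup_z A z.
  apply/seteqP; split=> p.
    move=> [q Uq]; rewrite !pi_bclass => /esym/bclass_eqP => /(_ (fp_pi p) (fp_pi q)).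
    by move=> [z hz]; exists z => //; exists q.
  move=> [z _ [q Uq hz]]; exists q => //; rewrite !pi_bclass.
  by apply/esym/bclass_eqP; [exact: fp_pi|exact: fp_pi|exists z].
apply: bigcup_open => z _; rewrite openE => p [q Uq [e1 e2]].
have mp (p' : FP) : tw_pi (tw_act z (fp1 p')) = tw_pi (tw_act (circleC z) (fp2 p')).
  by rewrite (pcb_act_fiber b1) (pcb_act_fiber b2); exact: fp_pi.
pose h (p' : FP) : FP := projT1 (cid (fp_mk (mp p'))).
have hE p' : fp1 (h p') = tw_act z (fp1 p') /\
    fp2 (h p') = tw_act (circleC z) (fp2 p') by rewrite /h; case: cid.
have fpI (p' q' : FP) : fp1 p' = fp1 q' -> fp2 p' = fp2 q' -> p' = q'.
  by move=> ee1 ee2; apply: val_inj; apply: injective_projections.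
have hp : h p = q by apply: fpI; rewrite ?(hE p).1 ?(hE p).2.
have ch : h @ nbhs p --> h p.
  apply: cvg_set_val.
  rewrite [set_val (h p)]surjective_pairing.
  have -> : (fun p' => set_val (h p')) =
      (fun p' => (tw_act z (fp1 p'), tw_act (circleC z) (fp2 p'))).
    apply/funext => p'; rewrite -(hE p').1 -(hE p').2.
    by rewrite /fp1 /fp2 -surjective_pairing.
  rewrite -[(set_val (h p)).1]/(fp1 (h p)) -[(set_val (h p)).2]/(fp2 (h p)).
  rewrite (hE p).1 (hE p).2; apply: cvg_prod.
    by apply: (pcb_act_cvg b1); [exact: cvg_cst|exact: fp1_cts].
  by apply: (pcb_act_cvg b2); [exact: cvg_cst|exact: fp2_cts].
have nU : \forall p' \near p, U (h p') by apply: (cvg_open ch oU); rewrite hp.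
apply: filterS nU => p' Up'; exists (h p') => //; exact: hE.
Qed.

Lemma baer_pi_surj (x : B) : exists p : FP, \pi_B p = x.
Proof. by exists (repr x); rewrite reprK. Qed.

(** Sections are classes of pairs of sections, and division is the product of
    the divisions of both components, in which the ambiguity of the
    representatives cancels out. *)
Lemma baer_bundle : principal_circle_bundle (@tw_pi _ _ _ S) (@tw_act _ _ _ S).
Proof.
have cpi1 := pcb_cts b1.
pose d (x y : S) : TT :=
  circleM (pdiv (@tw_act _ _ _ T1) (fp1 (repr (x : B))) (fp1 (repr (y : B))))
          (pdiv (@tw_act _ _ _ T2) (fp2 (repr (x : B))) (fp2 (repr (y : B)))).
have dE (r1 s1 : T1) (r2 s2 : T2) : tw_pi r1 = tw_pi r2 -> tw_pi s1 = tw_pi s2 ->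
    tw_pi r1 = tw_pi s1 -> d (bclass r1 r2) (bclass s1 s2) =
    circleM (pdiv (@tw_act _ _ _ T1) r1 s1) (pdiv (@tw_act _ _ _ T2) r2 s2).
  move=> e e' rs; rewrite /d.
  have [w [-> ->]] := repr_bclass e; have [w' [-> ->]] := repr_bclass e'.
  have rs2 : tw_pi r2 = tw_pi s2 by rewrite -e -e'.
  have pd (T : twist R G) (h : is_twist T) (u u' : TT) (r s : T) :
      tw_pi r = tw_pi s -> pdiv (@tw_act _ _ _ T) (tw_act u r) (tw_act u' s) =
      circleM (circleM u' (circleC u)) (pdiv (@tw_act _ _ _ T) r s).
    move=> pirs; apply: (pdivE (tw_bundle h)).
    rewrite -[in RHS](pdivK (tw_bundle h) pirs) -!(pcb_actM (tw_bundle h)).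
    rewrite -!circleMA; congr (tw_act (circleM _ _)).
    by rewrite circleMC -circleMA circleCr circleM1.
  rewrite (pd T1) // (pd T2) // circleCK.
  rewrite -!circleMA; set a := pdiv _ r1 s1; set b := pdiv _ r2 s2.
  have -> : circleM (circleC w') (circleM w b) = circleM w (circleM (circleC w') b).
    by rewrite !circleMA (circleMC w).
  rewrite (circleMA a) (circleMC a) -(circleMA w) (circleMA (circleC w)) circleCl.
  by rewrite circle1M (circleMC a) -circleMA circleMA circleCr circle1M circleMC.
apply: (pcb_intro (d := d)).
- apply/continuous_subspace_setT.
  apply: (cts_open_map baer_open_map baer_pi_surj).
  apply: continuous_subspaceT.
  have -> : (@tw_pi _ _ _ S) \o \pi_B = (@tw_pi _ _ _ T1) \o @fp1 _ _ _ T1 T2.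
    by apply/funext => p /=; rewrite pi_bclass [LHS]tw_pi_bclass ?fp_pi.
  exact: (cts_comp fp1_cts cpi1).
- apply/continuous_subspace_setT.
  apply: (cts_open_map (open_map_prod (@open_map_id TT) baer_open_map)).
    by move=> [z x]; have [p <-] := baer_pi_surj x; exists (z, p).
  apply: continuous_subspaceT => -[z p].
  rewrite /continuous_at /= pi_bclass [X in _ --> X]tw_act_bclass ?fp_pi //.
  apply: (@cvg_near_eq _ _ _ (fun q => bclass (tw_act q.1 (fp1 q.2)) (fp2 q.2))).
    by apply: nearW => -[z' p'] /=; rewrite pi_bclass [LHS]tw_act_bclass ?fp_pi.
  apply: bclass_cvg.
  + apply: (pcb_act_cvg b1); first exact: cvg_fst.
    by apply: (cvg_cts _ fp1_cts); exact: cvg_snd.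
  + by apply: (cvg_cts _ fp2_cts); exact: cvg_snd.
  + by rewrite (pcb_act_fiber b1) fp_pi.
  + by apply: nearW => q; rewrite (pcb_act_fiber b1) fp_pi.
- move=> x; have [r1 [r2 [e ->]]] := bclassP x.
  by rewrite tw_act_bclass // (pcb_act1 b1).
- move=> z w x; have [r1 [r2 [e ->]]] := bclassP x.
  by rewrite !tw_act_bclass ?(pcb_act_fiber b1) // (pcb_actM b1).
- move=> z x; have [r1 [r2 [e ->]]] := bclassP x.
  by rewrite tw_act_bclass // !tw_pi_bclass ?(pcb_act_fiber b1).
- move=> g; have [U1 [s1 [k1 [oU1 Ug1 s1P _ _]]]] := pcb_local b1 g.
  have [U2 [s2 [k2 [oU2 Ug2 s2P _ _]]]] := pcb_local b2 g.
  exists (U1 `&` U2), (fun c => bclass (s1 c) (s2 c)).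
  have oU : open (U1 `&` U2) by exact: openI.
  split=> // c [Uc1 Uc2]; have [p1 c1] := s1P c Uc1; have [p2 c2] := s2P c Uc2.
  split; first by rewrite tw_pi_bclass p1 ?p2.
  apply: bclass_cvg => //; first by rewrite p1 p2.
  have nU : \forall x \near c, (U1 `&` U2) x by exact: open_nbhs_nbhs.
  by apply: filterS nU => x [Ux1 Ux2]; rewrite (s1P _ Ux1).1 (s2P _ Ux2).1.
- move=> x y; have [r1 [r2 [e ->]]] := bclassP x.
  have [t1 [t2 [e' ->]]] := bclassP y; rewrite !tw_pi_bclass // => rs.
  have rs2 : tw_pi r2 = tw_pi t2 by rewrite -e -e'.
  rewrite dE // tw_act_bclass // circleMC (pcb_actM b1).
  rewrite bclass_act; last by rewrite (pcb_act_fiber b1).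
  by rewrite (pdivK b1) // (pdivK b2).
- move=> z x; have [r1 [r2 [e ->]]] := bclassP x.
  rewrite tw_act_bclass // dE ?(pcb_act_fiber b1) // (pdiv_act b1).
  by rewrite (pdivE b2 (pcb_act1 b2 r2)) circleM1.
- apply: (cts_open_map (open_map_prod baer_open_map baer_open_map)).
    move=> [x y]; have [p <-] := baer_pi_surj x; have [q <-] := baer_pi_surj y.
    by exists (p, q).
  apply/subspace_continuousP => -[p q] pq0.
  have : tw_pi (\pi_B p : S) = tw_pi (\pi_B q : S) := pq0.
  rewrite !tw_pi_pi => {pq0} pq.
  have pq2 : tw_pi (fp2 p) = tw_pi (fp2 q) by rewrite -!fp_pi.
  rewrite /from_subspace /= !pi_bclass dE ?fp_pi //.
  set A := (X in within X).
  have nA : \forall u \near within A (nbhs (p, q)),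
      tw_pi (fp1 u.1) = tw_pi (fp1 u.2).
    apply: filterS (near_withinA A (p, q)) => u Au.
    have : tw_pi (\pi_B u.1 : S) = tw_pi (\pi_B u.2 : S) := Au.
    by rewrite !tw_pi_pi.
  apply: (@cvg_near_eq _ _ _ (fun u => circleM
      (pdiv (@tw_act _ _ _ T1) (fp1 u.1) (fp1 u.2))
      (pdiv (@tw_act _ _ _ T2) (fp2 u.1) (fp2 u.2)))).
    apply: filterS nA => u Au.
    rewrite -[LHS]/(d (\pi_B u.1) (\pi_B u.2)) !pi_bclass.
    by apply: dE => //; exact: fp_pi.
  have f1 := @cvg_fst_within _ _ A (p, q).
  have f2 := @cvg_snd_within _ _ A (p, q).
  apply: circleM_cvg.
    apply: (pdiv_cvg b1) => //; first exact: (cvg_cts _ fp1_cts f1).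
    exact: (cvg_cts _ fp1_cts f2).
  apply: (pdiv_cvg b2) => //; first exact: (cvg_cts _ fp2_cts f1).
    exact: (cvg_cts _ fp2_cts f2).
  by apply: filterS nA => u Au; rewrite -!fp_pi.
Qed.

Lemma baer_is_twist : is_twist S.
Proof.
apply: twist_intro => //.
- exact: baer_is_groupoid.
- split.
  + move=> x; have [r1 [r2 [e ->]]] := bclassP x.
    by rewrite tw_pi_bclass // src_bclass // (hom_src (tw_hom h1)).
  + move=> x; have [r1 [r2 [e ->]]] := bclassP x.
    by rewrite tw_pi_bclass // rng_bclass // (hom_rng (tw_hom h1)).
  + move=> x; rewrite unit_bclass tw_pi_bclass ?(hom_unit (tw_hom h1)) //.
    by rewrite (hom_unit (tw_hom h2)).
  + move=> x y; have [r1 [r2 [e ->]]] := bclassP x.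
    have [s1 [s2 [e' ->]]] := bclassP y.
    rewrite src_bclass // rng_bclass // => rs.
    rewrite gmul_bclass // !tw_pi_bclass //; last exact: pi_gmul.
    by rewrite (hom_mul (tw_hom h1)).
- exact: baer_bundle.
- move=> z w x y; have [r1 [r2 [e ->]]] := bclassP x.
  have [s1 [s2 [e' ->]]] := bclassP y.
  rewrite src_bclass // rng_bclass // => rs.
  have E := pi_gmul e e' rs.
  rewrite !tw_act_bclass // gmul_bclass ?(pcb_act_fiber b1) //.
    by rewrite (tw_compat h1) // gmul_bclass // tw_act_bclass.
  by rewrite (src_act h1) (rng_act h1).
- move=> x; rewrite /continuous_at unit_bclass.
  have -> : @unit_at _ S = fun x => bclass (unit_at T1 x) (unit_at T2 x).
    by apply/funext => y; exact: unit_bclass.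
  apply: bclass_cvg; first exact: (unit_cts (tw_lch h1)).
  + exact: (unit_cts (tw_lch h2)).
  + by rewrite (hom_unit (tw_hom h1)) (hom_unit (tw_hom h2)).
  + by apply: nearW => y; rewrite (hom_unit (tw_hom h1)) (hom_unit (tw_hom h2)).
- have ei (p : FP) : tw_pi (ginv (fp1 p)) = tw_pi (ginv (fp2 p)).
    by rewrite (pi_ginv h1) // (pi_ginv h2) // fp_pi.
  apply/continuous_subspace_setT.
  apply: (cts_open_map baer_open_map baer_pi_surj).
  apply: continuous_subspaceT.
  have -> : @ginv _ S \o \pi_B = (fun p => bclass (ginv (fp1 p)) (ginv (fp2 p))).
    by apply/funext => q /=; rewrite pi_bclass [LHS]ginv_bclass ?fp_pi.
  apply: bclass_cts => //.
  + exact: (cts_comp fp1_cts (ginv_cts (tw_lch h1))).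
  + exact: (cts_comp fp2_cts (ginv_cts (tw_lch h2))).
- apply: (cts_open_map (open_map_prod baer_open_map baer_open_map)).
    move=> [x y]; have [p <-] := baer_pi_surj x; have [q <-] := baer_pi_surj y.
    by exists (p, q).
  apply/subspace_continuousP => -[p q] pq0.
  have : src (\pi_B p : S) = rng (\pi_B q : S) := pq0.
  rewrite src_pi rng_pi => {pq0} pq.
  have pq2 := bclass_src_rng (fp_pi p) (fp_pi q) pq.
  rewrite /from_subspace /= !pi_bclass [X in _ --> X]gmul_bclass ?fp_pi //.
  set A := (X in within X).
  have nA : \forall u \near within A (nbhs (p, q)), src (fp1 u.1) = rng (fp1 u.2).
    apply: filterS (near_withinA A (p, q)) => u Au.
    have : src (\pi_B u.1 : S) = rng (\pi_B u.2 : S) := Au.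
    by rewrite src_pi rng_pi.
  apply: (@cvg_near_eq _ _ _ (fun u : FP * FP =>
      bclass (gmul (fp1 u.1) (fp1 u.2)) (gmul (fp2 u.1) (fp2 u.2)))).
    apply: filterS nA => u Au.
    rewrite -[LHS]/(gmul (\pi_B u.1 : S) (\pi_B u.2 : S)) !pi_bclass.
    by rewrite gmul_bclass ?fp_pi.
  have f1 := @cvg_fst_within _ _ A (p, q).
  have f2 := @cvg_snd_within _ _ A (p, q).
  apply: bclass_cvg.
  + apply: (gmul_cvg h1) => //; first exact: (cvg_cts _ fp1_cts f1).
    exact: (cvg_cts _ fp1_cts f2).
  + apply: (gmul_cvg h2) => //; first exact: (cvg_cts _ fp2_cts f1).
      exact: (cvg_cts _ fp2_cts f2).
    by apply: filterS nA => u; apply: bclass_src_rng; exact: fp_pi.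
  + by apply: pi_gmul => //; exact: fp_pi.
  + by apply: filterS nA => u Au; apply: pi_gmul => //; exact: fp_pi.
Qed.

End BaerSumTwist.

(** * Pairings and the group laws *)

Section BasicTwists.
Variables (R : realType) (X : topologicalType) (G : groupoid_data X).
Hypothesis hG : lch_groupoid G.
Local Notation TT := (circle R).
Let gG := lch_is_groupoid hG.

Lemma trivial_twist_is_twist : is_twist (trivial_twist R G).
Proof.
apply: twist_intro => //.
- split=> /=.
  + by move=> x; rewrite (src_unit gG).
  + by move=> x; rewrite (rng_unit gG).
  + by move=> [g z] [h w] /= gh; rewrite (src_mul gG).
  + by move=> [g z] [h w] /= gh; rewrite (rng_mul gG).
  + move=> [g z] [h w] [k u] /= gh hk.
    by rewrite (gmulA gG) // circleMA.
  + by move=> [g z] /=; rewrite (gmul1l gG) circle1M.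
  + by move=> [g z] /=; rewrite (gmul1r gG) circleM1.
  + by move=> [g z] /=; rewrite (src_inv gG).
  + by move=> [g z] /=; rewrite (rng_inv gG).
  + by move=> [g z] /=; rewrite (gmulV gG) circleCr.
  + by move=> [g z] /=; rewrite (gmulVl gG) circleCl.
- apply: (pcb_intro (d := fun p q : trivial_twist R G => circleM q.2 (circleC p.2))).
  + exact: fst_cts.
  + have c : continuous (fun q : TT * (G * TT) => (q.2.1, circleM q.1 q.2.2)).
      move=> q; apply: cvg_prod.
        exact: (cts_comp (@snd_cts _ _) (@fst_cts _ _)).
      apply: circleM_cvg; first exact: fst_cts.
      exact: (cts_comp (@snd_cts _ _) (@snd_cts _ _)).
    exact: c.
  + by move=> [g z] /=; rewrite circle1M.
  + by move=> z w [g u] /=; rewrite circleMA.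
  + by [].
  + move=> g; exists setT, (fun g => (g, circle1 R)); split=> //.
      exact: openT.
    by move=> c _; split=> //; apply: cvg_prod; [exact: cvg_id|exact: cvg_cst].
  + by move=> [g z] [h w] /= ->; rewrite -circleMA circleCl circleM1.
  + by move=> z [g w] /=; rewrite -circleMA circleCr circleM1.
  + apply: continuous_subspaceT => p; apply: circleM_cvg.
      exact: (cts_comp (@snd_cts _ _) (@snd_cts _ _)).
    by apply: circleC_cvg; exact: (cts_comp (@fst_cts _ _) (@snd_cts _ _)).
- move=> z w [g u] [h v] /= gh; congr (_, _); rewrite -!circleMA; congr circleM.
  by rewrite !circleMA (circleMC u).
- by move=> x; apply: cvg_prod; [exact: (unit_cts hG)|exact: cvg_cst].
- have c : continuous (fun p : G * TT => (ginv p.1, circleC p.2)).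
    move=> p; apply: cvg_prod.
      exact: (cts_comp (@fst_cts _ _) (ginv_cts hG)).
    by apply: circleC_cvg; exact: snd_cts.
  exact: c.
- pose A := [set p : (G * TT) * (G * TT) | src p.1.1 = rng p.2.1].
  have c : {within A, continuous
      (fun q => (gmul q.1.1 q.2.1, circleM q.1.2 q.2.2) : G * TT)}.
    apply/subspace_continuousP => p gh.
    have f1 := @cvg_fst_within _ _ A p; have f2 := @cvg_snd_within _ _ A p.
    apply: cvg_prod.
      apply: (@cvg_within_comp _ _ _ _ (fun q => gmul q.1 q.2)
        (fun x : (G * TT) * (G * TT) => (x.1.1, x.2.1)) _ (p.1.1, p.2.1) _
        (gmul_cts hG)) => //; last exact: near_withinA.
      apply: cvg_prod; first exact: (cvg_cts _ (@fst_cts _ _) f1).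
      exact: (cvg_cts _ (@fst_cts _ _) f2).
    apply: circleM_cvg; first exact: (cvg_cts _ (@snd_cts _ _) f1).
    exact: (cvg_cts _ (@snd_cts _ _) f2).
  exact: c.
Qed.

Lemma conj_twist_is_twist (T : twist_data R G) :
  is_twist T -> is_twist (conj_twist T).
Proof.
move=> hT; have bT := tw_bundle hT.
split; [exact: tw_lch hT|exact: tw_hom hT| |].
- apply: (pcb_intro (d := fun p q : T => circleC (pdiv (@tw_act _ _ _ T) p q))).
  + exact: pcb_cts bT.
  + move=> [z r]; apply: (pcb_act_cvg bT); last exact: snd_cts.
    by apply: circleC_cvg; exact: fst_cts.
  + by move=> r /=; rewrite circleC1 (pcb_act1 bT).
  + by move=> z w r /=; rewrite circleCM (pcb_actM bT).
  + by move=> z r; exact: (pcb_act_fiber bT).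
  + move=> b; have [U [s [k [oU Ub sP _ _]]]] := pcb_local bT b.
    by exists U, s.
  + by move=> r r' e /=; rewrite circleCK (pdivK bT).
  + by move=> z r /=; rewrite (pdiv_act bT) circleCK.
  + apply/subspace_continuousP => p pp; apply: circleC_cvg.
    by have /subspace_continuousP := pdiv_cts bT; exact.
- by move=> z w r s rs /=; rewrite (tw_compat hT) // circleCM.
Qed.

Definition trivial_tw : twist R G := Twist trivial_twist_is_twist.
Definition conj_tw (T : twist R G) : twist R G :=
  Twist (conj_twist_is_twist (twistP T)).
Definition baer_tw (T1 T2 : twist R G) : twist R G :=
  Twist (baer_is_twist hG T1 T2).

(** The analogue of a bilinear map, with the fiber product as its domain: such an
    [F] descends to a morphism of twists on the Baer sum. *)
Record pairing (T1 T2 : twist R G) (T3 : twist_data R G)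
    (F : T1 -> T2 -> T3) : Prop := {
  pr_pi : forall r1 r2, tw_pi r1 = tw_pi r2 -> tw_pi (F r1 r2) = tw_pi r1;
  pr_actl : forall z r1 r2, tw_pi r1 = tw_pi r2 ->
    F (tw_act z r1) r2 = tw_act z (F r1 r2);
  pr_actr : forall z r1 r2, tw_pi r1 = tw_pi r2 ->
    F r1 (tw_act z r2) = tw_act z (F r1 r2);
  pr_mul : forall r1 r2 s1 s2, tw_pi r1 = tw_pi r2 -> tw_pi s1 = tw_pi s2 ->
    src r1 = rng s1 ->
    F (gmul r1 s1) (gmul r2 s2) = gmul (F r1 r2) (F s1 s2);
  pr_cts : {within @fiber_prod _ _ _ T1 T2, continuous (fun p => F p.1 p.2)}
}.

(** Since a morphism of twists is invertible, the Baer sum represents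
    pairings: a pairing with values in a twist exhibits it as the Baer sum. *)
Lemma pairing_iso (T1 T2 : twist R G) (T3 : twist_data R G)
    (F : T1 -> T2 -> T3) :
  is_twist T3 -> pairing F -> twist_iso (baer_sum T1 T2) T3.
Proof.
move=> h3 pF; have h1 := twistP T1; have h2 := twistP T2.
have b1 := tw_bundle h1; have b2 := tw_bundle h2; have b3 := tw_bundle h3.
pose f (x : baer_sum T1 T2) : T3 := F (fp1 (repr (x : baer_space T1 T2)))
                                      (fp2 (repr (x : baer_space T1 T2))).
have fE r1 r2 : tw_pi r1 = tw_pi r2 -> f (bclass r1 r2) = F r1 r2.
  move=> e; have [w [e1 e2]] := repr_bclass e; rewrite /f e1 e2.
  rewrite (pr_actl pF) ?(pcb_act_fiber b1) ?(pcb_act_fiber b2) //.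
  rewrite (pr_actr pF) ?(pcb_act_fiber b2) //.
  by rewrite -(pcb_actM b3) circleCr (pcb_act1 b3).
apply: (@twist_morphism_iso _ _ _ _ _ f) => //.
- exact: baer_is_twist.
- apply/continuous_subspace_setT.
  apply: (cts_open_map (@baer_open_map _ _ _ T1 T2) (@baer_pi_surj _ _ _ T1 T2)).
  apply: continuous_subspaceT.
  have -> : f \o \pi_(baer_space T1 T2) = fun p => F (fp1 p) (fp2 p).
    by apply/funext => p /=; rewrite pi_bclass fE ?fp_pi.
  by have /subspace_sigL_continuousP h := pr_cts pF; exact: h.
- move=> x; have [r1 [r2 [e ->]]] := bclassP x.
  by rewrite fE // tw_pi_bclass // (pr_pi pF).
- move=> z x; have [r1 [r2 [e ->]]] := bclassP x.
  by rewrite tw_act_bclass // !fE ?(pcb_act_fiber b1) // (pr_actl pF).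
- move=> x y; have [r1 [r2 [e ->]]] := bclassP x.
  have [s1 [s2 [e' ->]]] := bclassP y.
  rewrite src_bclass // rng_bclass // => rs.
  rewrite gmul_bclass // !fE //; last exact: pi_gmul.
  exact: (pr_mul pF).
Qed.

Lemma within_fiber_prod (T1 T2 : twist R G) (W : topologicalType)
    (f : T1 * T2 -> W) :
  (forall r1 r2, tw_pi r1 = tw_pi r2 ->
    f @ within (@fiber_prod _ _ _ T1 T2) (nbhs (r1, r2)) --> f (r1, r2)) ->
  {within @fiber_prod _ _ _ T1 T2, continuous f}.
Proof. by move=> cf; apply/subspace_continuousP => -[r1 r2]; exact: cf. Qed.

Lemma baer_functorial (S1 S2 T1 T2 : twist R G) :
  twist_iso S1 T1 -> twist_iso S2 T2 ->
  twist_iso (baer_sum S1 S2) (baer_sum T1 T2).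
Proof.
move=> [f1 [_ [[_ _ _ _ cf1 _] hf1 fpi1 fact1]]].
move=> [f2 [_ [[_ _ _ _ cf2 _] hf2 fpi2 fact2]]].
have {}cf1 : continuous f1 by apply/continuous_subspace_setT.
have {}cf2 : continuous f2 by apply/continuous_subspace_setT.
apply: (@pairing_iso _ _ _ (fun r1 r2 => bclass (f1 r1) (f2 r2))).
  exact: baer_is_twist.
have fe r1 r2 : tw_pi r1 = tw_pi r2 -> tw_pi (f1 r1) = tw_pi (f2 r2).
  by rewrite fpi1 fpi2.
split.
- by move=> r1 r2 e; rewrite tw_pi_bclass ?fpi1 ?fpi2.
- by move=> z r1 r2 e; rewrite fact1 tw_act_bclass ?fpi1 ?fpi2.
- move=> z r1 r2 e; rewrite fact2 tw_act_bclass ?fpi1 ?fpi2 //.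
  by rewrite bclass_act ?fpi1 ?fpi2.
- move=> r1 r2 s1 s2 e e' rs; have rs2 := bclass_src_rng e e' rs.
  rewrite (hom_mul hf1) // (hom_mul hf2) // gmul_bclass ?fpi1 ?fpi2 //.
  by rewrite (hom_src hf1) (hom_rng hf1).
- apply: within_fiber_prod => r1 r2 e.
  set A := (X in within X).
  apply: bclass_cvg; last 2 first.
  + exact: fe.
  + by apply: filterS (near_withinA A (r1, r2)) => u; exact: fe.
  + exact: (cvg_cts _ cf1 (@cvg_fst_within _ _ A (r1, r2))).
  + exact: (cvg_cts _ cf2 (@cvg_snd_within _ _ A (r1, r2))).
Qed.

(** Commutativity halves the work on the unit and inverse laws. *)
Lemma baer_comm (T1 T2 : twist R G) :
  twist_iso (baer_sum T1 T2) (baer_sum T2 T1).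
Proof.
apply: (@pairing_iso _ _ _ (fun r1 r2 => bclass r2 r1)).
  exact: baer_is_twist.
have b1 := tw_bundle (twistP T1); have b2 := tw_bundle (twistP T2).
split.
- by move=> r1 r2 e; rewrite tw_pi_bclass.
- by move=> z r1 r2 e; rewrite -bclass_act // tw_act_bclass.
- by move=> z r1 r2 e; rewrite tw_act_bclass.
- move=> r1 r2 s1 s2 e e' rs; have rs2 := bclass_src_rng e e' rs.
  by rewrite gmul_bclass.
- apply: within_fiber_prod => r1 r2 e; set A := (X in within X).
  apply: bclass_cvg => //.
  + exact: (@cvg_snd_within _ _ A (r1, r2)).
  + exact: (@cvg_fst_within _ _ A (r1, r2)).
  + by apply: filterS (near_withinA A (r1, r2)) => u ->.
Qed.

(** The second argument of the pairing (r1, [r2, r3]) |-> [[r1, r2], r3] lives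
    in a quotient; its continuity is tested on representatives, the product of
    the projection with an identity map being open. *)
Lemma baer_assoc (T1 T2 T3 : twist R G) :
  twist_iso (baer_sum T1 (baer_tw T2 T3)) (baer_sum (baer_tw T1 T2) T3).
Proof.
pose B := baer_space T2 T3.
have b1 := tw_bundle (twistP T1); have b2 := tw_bundle (twistP T2).
have b3 := tw_bundle (twistP T3).
pose F (r1 : T1) (x : baer_tw T2 T3) : baer_sum (baer_tw T1 T2) T3 :=
  @bclass _ _ _ (baer_tw T1 T2) T3 (bclass r1 (fp1 (repr (x : B))))
                                   (fp2 (repr (x : B))).
have pi12 (r1 : T1) (r2 : T2) (r3 : T3) : tw_pi r1 = tw_pi r2 ->
    tw_pi r2 = tw_pi r3 ->
    tw_pi (bclass r1 r2 : baer_tw T1 T2) = tw_pi r3.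
  by move=> e e'; rewrite [LHS]tw_pi_bclass // e.
have FE r1 r2 r3 : tw_pi r1 = tw_pi r2 -> tw_pi r2 = tw_pi r3 ->
    F r1 (bclass r2 r3) = @bclass _ _ _ (baer_tw T1 T2) T3 (bclass r1 r2) r3.
  move=> e e'; have [w [e1 e2]] := repr_bclass e'; rewrite /F e1 e2.
  rewrite -[LHS]bclass_act; last by apply: pi12; rewrite ?(pcb_act_fiber b2).
  congr (@bclass _ _ _ (baer_tw T1 T2) T3 _ _).
  rewrite [LHS]tw_act_bclass ?(pcb_act_fiber b2) //.
  rewrite bclass_act ?(pcb_act_fiber b2) // -(pcb_actM b2).
  by rewrite circleCl (pcb_act1 b2).
have xP r1 (x : baer_tw T2 T3) : tw_pi r1 = tw_pi x ->
    exists r2 r3, [/\ tw_pi r1 = tw_pi r2, tw_pi r2 = tw_pi r3 & x = bclass r2 r3].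
  have [r2 [r3 [e ->]]] := bclassP x; rewrite [RHS]tw_pi_bclass // => e'.
  by exists r2, r3.
apply: (@pairing_iso _ _ _ F); first exact: (baer_is_twist hG (baer_tw T1 T2) T3).
split.
- move=> r1 x /xP[r2 [r3 [e e' ->]]]; rewrite FE //.
  by rewrite tw_pi_bclass; [exact: tw_pi_bclass|exact: pi12].
- move=> z r1 x /xP[r2 [r3 [e e' ->]]].
  rewrite !FE ?(pcb_act_fiber b1) // tw_act_bclass; last exact: pi12.
  by congr (@bclass _ _ _ (baer_tw T1 T2) T3 _ _); rewrite [RHS]tw_act_bclass.
- move=> z r1 x /xP[r2 [r3 [e e' ->]]].
  rewrite [tw_act z (bclass r2 r3)]tw_act_bclass // !FE ?(pcb_act_fiber b2) //.
  rewrite tw_act_bclass; last exact: pi12.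
  congr (@bclass _ _ _ (baer_tw T1 T2) T3 _ _).
  by rewrite [RHS]tw_act_bclass // bclass_act.
- move=> r1 x s1 y /xP[r2 [r3 [e e' ->]]] /xP[s2 [s3 [f f' ->]]] rs.
  have rs2 := bclass_src_rng e f rs; have rs3 := bclass_src_rng e' f' rs2.
  have E := pi_gmul e f rs; have E' := pi_gmul e' f' rs2.
  rewrite [gmul (bclass r2 r3) _]gmul_bclass // !FE //.
  rewrite gmul_bclass; [|exact: pi12|exact: pi12|]; last first.
    by rewrite [LHS]src_bclass // [RHS]rng_bclass.
  by congr (@bclass _ _ _ (baer_tw T1 T2) T3 _ _); rewrite [RHS]gmul_bclass.
- apply: (cts_open_map (open_map_prod (@open_map_id T1) (@baer_open_map _ _ _ T2 T3))).
    by move=> [r1 x]; have [p <-] := baer_pi_surj x; exists (r1, p).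
  apply/subspace_continuousP => -[r1 p] rp0.
  have rpE (u : T1 * fiber_prod_space T2 T3) :
      (@fiber_prod _ _ _ T1 (baer_tw T2 T3)) (u.1, \pi_B u.2) ->
      tw_pi u.1 = tw_pi (fp1 u.2).
    by rewrite /fiber_prod /= => ->; exact: tw_pi_pi.
  have rp : tw_pi r1 = tw_pi (fp1 p) := rpE (r1, p) rp0.
  set A := (X in within X).
  have nA : \forall u \near within A (nbhs (r1, p)), tw_pi u.1 = tw_pi (fp1 u.2).
    by apply: filterS (near_withinA A (r1, p)) => u; exact: rpE.
  have f1 := @cvg_fst_within _ _ A (r1, p).
  have f2 := @cvg_snd_within _ _ A (r1, p).
  have FpE (u : T1 * fiber_prod_space T2 T3) : tw_pi u.1 = tw_pi (fp1 u.2) ->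
      F u.1 (\pi_B u.2) =
      @bclass _ _ _ (baer_tw T1 T2) T3 (bclass u.1 (fp1 u.2)) (fp2 u.2).
    by move=> e; rewrite pi_bclass FE // fp_pi.
  have lE := FpE (r1, p) rp.
  rewrite -[X in _ --> X]/(F r1 (\pi_B p)) lE.
  apply: (@cvg_near_eq _ _ _ (fun u : T1 * fiber_prod_space T2 T3 =>
      @bclass _ _ _ (baer_tw T1 T2) T3 (bclass u.1 (fp1 u.2)) (fp2 u.2))).
    by apply: filterS nA => u; exact: FpE.
  apply: (@bclass_cvg _ _ _ (baer_tw T1 T2) T3).
  + apply: bclass_cvg => //; exact: (cvg_cts _ (@fp1_cts _ _ _ T2 T3) f2).
  + exact: (cvg_cts _ (@fp2_cts _ _ _ T2 T3) f2).
  + by apply: pi12 => //; exact: fp_pi.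
  + by apply: filterS nA => u e; apply: pi12 => //; exact: fp_pi.
Qed.

Lemma baer_0l (T : twist R G) : twist_iso (baer_sum trivial_tw T) T.
Proof.
have hT := twistP T; have bT := tw_bundle hT.
apply: (@pairing_iso _ _ _ (fun (p : trivial_tw) (r : T) => tw_act p.2 r)) => //.
split.
- by move=> p r e; rewrite (pcb_act_fiber bT).
- by move=> z p r e /=; rewrite (pcb_actM bT).
- by move=> z p r e /=; rewrite -!(pcb_actM bT) circleMC.
- move=> [g z] r [h w] s /= gr hs gh; rewrite (tw_compat hT) //.
  by rewrite -(hom_src (tw_hom hT)) -(hom_rng (tw_hom hT)) -gr -hs.
- apply: continuous_subspaceT => p; apply: (pcb_act_cvg bT); last exact: snd_cts.
  exact: (cts_comp (@fst_cts _ _) (@snd_cts _ _)).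
Qed.

(** Multiplying [r] by the conjugate of [z] multiplies the division s / r by
    [z], so that division is homogeneous for the conjugate action. *)
Lemma baer_conjl (T : twist R G) :
  twist_iso (baer_sum (conj_tw T) T) (trivial_twist R G).
Proof.
have hT := twistP T; have bT := tw_bundle hT.
have gT := lch_is_groupoid (tw_lch hT).
pose d := pdiv (@tw_act _ _ _ T).
apply: (@pairing_iso (conj_tw T) _ _
  (fun (r : T) (s : T) => (tw_pi r, d r s) : trivial_twist R G)).
  exact: trivial_twist_is_twist.
split.
- by [].
- move=> z r s /= e; congr (_, _); first exact: (pcb_act_fiber bT).
  apply: (pdivE bT); rewrite -(pcb_actM bT) (circleMC z) -circleMA circleCr.
  by rewrite circleM1 (pdivK bT).
- move=> z r s /= e; congr (_, _).
  by apply: (pdivE bT); rewrite (pcb_actM bT) (pdivK bT).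
- move=> r r' s s' /= e e' rs; congr (_, _); first exact: (hom_mul (tw_hom hT)).
  apply: (pdivE bT); rewrite -(tw_compat hT) // !(pdivK bT) //.
- apply: (@within_fiber_prod (conj_tw T)) => r s /= e; set A := (X in within X).
  have f1 := @cvg_fst_within _ _ A (r, s).
  have f2 := @cvg_snd_within _ _ A (r, s).
  apply: (@cvg_prod _ _ _ (fun x : T * T => tw_pi x.1) (fun x => d x.1 x.2)
    (within A (nbhs (r, s)))); first exact: (cvg_cts _ (pcb_cts bT) f1).
  by apply: (pdiv_cvg bT) => //; exact: near_withinA.
Qed.

End BasicTwists.

Section TwistGroup.
Variables (R : realType) (X : topologicalType) (G : groupoid_data X).
Hypothesis hG : lch_groupoid G.

(** Classes are predicates, so that equality in the group of twists is
    extensional; it is reduced here to the existence of an isomorphism. *)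
Lemma iso_class_eq (D D' : twist_data R G) : twist_iso D D' ->
  (fun S : twist R G => twist_iso S D) = (fun S : twist R G => twist_iso S D').
Proof.
move=> h; apply/funext => S; apply/propext; split=> hS.
  exact: twist_iso_trans hS h.
exact: twist_iso_trans hS (twist_iso_sym h).
Qed.

Lemma tw_add_class (T1 T2 : twist R G) :
  tw_add (twist_class T1) (twist_class T2) = twist_class (baer_tw hG T1 T2).
Proof.
apply/funext => S; apply/propext; split=> [[S1 [S2 [i1 i2 i]]]|i].
  exact: twist_iso_trans i (baer_functorial hG i1 i2).
by exists T1, T2; split=> //; exact: twist_iso_refl.
Qed.

Lemma tw_opp_class (T : twist R G) :
  tw_opp (twist_class T) = twist_class (conj_tw T).
Proof.
apply/funext => S; apply/propext; split=> [[T' [f [g [hfg hf fpi fact]]] i]|i].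
  apply: (twist_iso_trans i); exists f, g; split=> // z r.
  exact: fact.
by exists T => //; exact: twist_iso_refl.
Qed.

Lemma Tw_is_group :
  is_group (@Tw R X G) (@tw_add R X G) (@tw_zero R X G) (@tw_opp R X G).
Proof.
have addC (S T : twist R G) :
    tw_add (twist_class S) (twist_class T) =
    tw_add (twist_class T) (twist_class S).
  by rewrite !tw_add_class; apply: iso_class_eq; exact: baer_comm.
have z0 : @tw_zero R X G = twist_class (trivial_tw R hG) by [].
have add0 (T : twist R G) :
    tw_add (@tw_zero R X G) (twist_class T) = twist_class T.
  by rewrite z0 tw_add_class; apply: iso_class_eq; exact: baer_0l.
have addN (T : twist R G) :
    tw_add (tw_opp (twist_class T)) (twist_class T) = @tw_zero R X G.
  rewrite tw_opp_class tw_add_class; apply: iso_class_eq.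
  exact: (baer_conjl hG T).
split.
- by move=> _ _ [S ->] [T ->]; rewrite tw_add_class; exists (baer_tw hG S T).
- by exists (trivial_tw R hG).
- by move=> _ [T ->]; rewrite tw_opp_class; exists (conj_tw T).
- move=> _ _ _ [T1 ->] [T2 ->] [T3 ->]; rewrite !tw_add_class.
  by apply: iso_class_eq; exact: baer_assoc.
- by move=> _ [T ->].
- by move=> _ [T ->]; rewrite z0 addC -z0.
- by move=> _ [T ->].
- by move=> _ [T ->]; rewrite tw_opp_class addC -tw_opp_class.
Qed.

End TwistGroup.

(** * Limits of matrices *)

Section MatrixLimits.
Variable R : realType.
Local Notation C := (cplx R).
Variables (Z : Type) (F : set_system Z).
Hypothesis FF : Filter F.

Lemma cvg_mx m n (f : Z -> 'M[C]_(m, n)) (A : 'M[C]_(m, n)) :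
  (forall i j, f z i j @[z --> F] --> A i j) -> f @ F --> A.
Proof.
move=> fA B [P /= nP sPB].
have h : \forall z \near F, forall i, forall j, P i j (f z i j).
  apply: filter_forall => i; apply: filter_forall => j.
  exact: fA (nP i j).
suff : F (f @^-1` B) by [].
by apply: filterS h => z hz; apply: sPB.
Qed.

Lemma cvg_coord m n (f : Z -> 'M[C]_(m, n)) (A : 'M[C]_(m, n)) i j :
  f @ F --> A -> f z i j @[z --> F] --> A i j.
Proof. exact: (cvg_cts FF (@coord_continuous C m n i j)). Qed.

Lemma cvg_mulmx m n k (f : Z -> 'M[C]_(m, n)) (g : Z -> 'M[C]_(n, k))
    (A : 'M[C]_(m, n)) (B : 'M[C]_(n, k)) :
  f @ F --> A -> g @ F --> B -> f z *m g z @[z --> F] --> A *m B.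
Proof.
move=> fA gB; apply: cvg_mx => i j; rewrite mxE.
apply: (@cvg_near_eq _ _ _ (fun z => \sum_l f z i l * g z l j)).
  by apply: nearW => z; rewrite mxE.
have addc : continuous (fun p : C * C => p.1 + p.2) := @add_continuous C.
apply: (@cvg_big C _ +%R 0 xpredT addc _ _ _ (fun l z => f z i l * g z l j)) => l _.
exact: (@cvgM C Z F FF _ _ _ _ (cvg_coord fA) (cvg_coord gB)).
Qed.

Lemma cvg_trmx m n (f : Z -> 'M[C]_(m, n)) (A : 'M[C]_(m, n)) :
  f @ F --> A -> (f z)^T @[z --> F] --> A^T.
Proof.
move=> fA; apply: cvg_mx => i j; rewrite mxE.
apply: (@cvg_near_eq _ _ _ (fun z => f z j i)); last exact: cvg_coord.
by apply: nearW => z; rewrite mxE.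
Qed.

Lemma cvg_mxvec m n (f : Z -> 'M[C]_(m, n)) (A : 'M[C]_(m, n)) :
  f @ F --> A -> mxvec (f z) @[z --> F] --> mxvec A.
Proof.
move=> fA; apply: cvg_mx => i k; rewrite ord1; case/mxvec_indexP: k => i' j.
rewrite mxvecE; apply: (@cvg_near_eq _ _ _ (fun z => f z i' j)).
  by apply: nearW => z; rewrite mxvecE.
exact: cvg_coord.
Qed.

Lemma cvg_vec_mx m n (f : Z -> 'rV[C]_(m * n)) (A : 'rV[C]_(m * n)) :
  f @ F --> A -> vec_mx (f z) @[z --> F] --> vec_mx A.
Proof.
move=> fA; apply: cvg_mx => i j; rewrite mxE.
apply: (@cvg_near_eq _ _ _ (fun z => f z 0 (mxvec_index i j))).
  by apply: nearW => z; rewrite mxE.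
exact: cvg_coord.
Qed.

Lemma cvg_scalemx m n (a : Z -> C) (f : Z -> 'M[C]_(m, n)) (b : C)
    (A : 'M[C]_(m, n)) :
  a @ F --> b -> f @ F --> A -> a z *: f z @[z --> F] --> b *: A.
Proof.
move=> ab fA; apply: cvg_mx => i j; rewrite mxE.
apply: (@cvg_near_eq _ _ _ (fun z => a z * f z i j)).
  by apply: nearW => z; rewrite mxE.
exact: (@cvgM C Z F FF _ _ _ _ ab (cvg_coord fA)).
Qed.

Lemma cvg_conjmx m n (f : Z -> 'M[C]_(m, n)) (A : 'M[C]_(m, n)) :
  f @ F --> A -> map_mx Num.conj (f z) @[z --> F] --> map_mx Num.conj A.
Proof.
move=> fA; apply: cvg_mx => i j; rewrite mxE.
apply: (@cvg_near_eq _ _ _ (fun z => (f z i j)^*)).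
  by apply: nearW => z; rewrite mxE.
exact: (cvg_cts FF (@conj_cts R) (cvg_coord fA)).
Qed.

End MatrixLimits.

(** * Charts of vector bundles *)

Section LinearMaps.
Variable K : fieldType.

Definition fun_mx n m (L : 'rV[K]_n -> 'rV[K]_m) : 'M[K]_(n, m) :=
  \matrix_(i, j) L (delta_mx 0 i) 0 j.

Lemma fun_mxE n m (L : 'rV[K]_n -> 'rV[K]_m) u :
  linear L -> u *m fun_mx L = L u.
Proof.
move=> lL; pose L' : {linear 'rV[K]_n -> 'rV[K]_m} :=
  HB.pack L (GRing.isLinear.Build _ _ _ _ L lL).
rewrite -[RHS](mul_rV_lin1 L'); congr (_ *m _).
by apply/matrixP => i j; rewrite !mxE.
Qed.

Lemma eq_mulmx_row n m (A B : 'M[K]_(n, m)) :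
  (forall u : 'rV_n, u *m A = u *m B) -> A = B.
Proof. by move=> h; apply/row_matrixP => i; rewrite !rowE h. Qed.

End LinearMaps.

Section Charts.
Variables (R : realType) (X : topologicalType).
Local Notation C := (cplx R).

(** Local trivializations bundled in a record, which makes it possible to choose
    one at each point and to quantify over all of them. *)
Record chart (E : vbundle_data R X) := Chart {
  ch_dom : set X;
  ch_dim : nat;
  ch_phi : X * 'rV[C]_ch_dim -> E;
  ch_psi : E -> X * 'rV[C]_ch_dim;
  ch_open : open ch_dom;
  ch_dim_gt0 : (0 < ch_dim)%N;
  ch_homeo : homeo_on (ch_dom `*` setT) (@vb_proj _ _ E @^-1` ch_dom)
               ch_phi ch_psi;
  ch_proj : forall y v, ch_dom y -> vb_proj (ch_phi (y, v)) = y;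
  ch_add : forall y v w, ch_dom y ->
    ch_phi (y, v + w) = vb_add (ch_phi (y, v)) (ch_phi (y, w));
  ch_scale : forall y (a : C) v, ch_dom y ->
    ch_phi (y, a *: v) = vb_scale a (ch_phi (y, v))
}.

Arguments ch_dom {E} c.
Arguments ch_dim {E} c.
Arguments ch_phi {E} c _.
Arguments ch_psi {E} c _.

Lemma chart_ex (E : vbundle_data R X) : is_vbundle E ->
  forall x, exists c : chart E, ch_dom c x.
Proof.
move=> hE x.
have [U [n [phi [psi [[oU Ux] n0 h pp [pa ps]]]]]] := vb_loc_triv hE x.
by exists (Chart oU n0 h pp pa ps).
Qed.

Definition frame (E : vbundle_data R X) (hE : is_vbundle E) (x : X) : chart E :=
  projT1 (cid (chart_ex hE x)).

Lemma frameP E (hE : is_vbundle E) x : ch_dom (frame hE x) x.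
Proof. by rewrite /frame; case: cid. Qed.

Section Theory.
Variable E : vbundle_data R X.
Implicit Types (c : chart E) (x y : X) (e : E).

Definition fib c e : 'rV[C]_(ch_dim c) := (ch_psi c e).2.

Lemma fib_phi c y v : ch_dom c y -> fib c (ch_phi c (y, v)) = v.
Proof.
by move=> cy; rewrite /fib (homeo_funK (ch_homeo c)) //; apply: mem_set.
Qed.

Lemma phi_fib c e : ch_dom c (vb_proj e) -> ch_phi c (vb_proj e, fib c e) = e.
Proof.
move=> ce; have [/= cp _] := homeo_inv (ch_homeo c) ce.
have eK : ch_phi c (ch_psi c e) = e.
  by apply: (homeo_invK (ch_homeo c)); apply: mem_set.
suff <- : (ch_psi c e).1 = vb_proj e by rewrite /fib -surjective_pairing.
by rewrite -[LHS](ch_proj (fib c e)) // /fib -surjective_pairing eK.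
Qed.

Lemma phi_cvg (Z : Type) (F : set_system Z) c (f : Z -> X)
    (g : Z -> 'rV[C]_(ch_dim c)) x v :
  Filter F -> ch_dom c x -> f @ F --> x -> g @ F --> v ->
  ch_phi c (f z, g z) @[z --> F] --> ch_phi c (x, v).
Proof.
move=> FF cx fx gv.
apply: (@cvg_within_comp _ _ _ _ (ch_phi c) (fun z => (f z, g z)) _ (x, v) _
  (homeo_cts (ch_homeo c))) => //; first exact: cvg_prod.
have nU : \forall z \near F, ch_dom c (f z) := cvg_open fx (ch_open c) cx.
by apply: filterS nU => z Uz.
Qed.

Lemma fib_cvg (Z : Type) (F : set_system Z) c (f : Z -> E) e :
  is_vbundle E -> Filter F -> ch_dom c (vb_proj e) -> f @ F --> e ->
  fib c (f z) @[z --> F] --> fib c e.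
Proof.
move=> hE FF ce fe.
have h : ch_psi c (f z) @[z --> F] --> ch_psi c e.
  apply: (@cvg_within_comp _ _ _ _ (ch_psi c) f _ e _
    (homeo_inv_cts (ch_homeo c))) => //.
  exact: (cvg_open (cvg_cts FF (vb_proj_cts hE) fe) (ch_open c) ce).
exact: (cvg_cts FF (@snd_cts _ _) h).
Qed.

Definition fiberwise_linear x y (f : E -> E) : Prop :=
  [/\ forall e, vb_proj e = x -> vb_proj (f e) = y,
      forall e e', vb_proj e = x -> vb_proj e' = x ->
        f (vb_add e e') = vb_add (f e) (f e') &
      forall (a : C) e, vb_proj e = x -> f (vb_scale a e) = vb_scale a (f e)].

Lemma fiberwise_linear_id x : fiberwise_linear x x id.
Proof. by []. Qed.

Lemma fib_add c e e' : ch_dom c (vb_proj e) -> vb_proj e = vb_proj e' ->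
  fib c (vb_add e e') = fib c e + fib c e'.
Proof.
move=> ce ee'; have ce' : ch_dom c (vb_proj e') by rewrite -ee'.
by rewrite -{1}(phi_fib ce) -{1}(phi_fib ce') -ee' -ch_add // fib_phi.
Qed.

Lemma fib_scale c a e : ch_dom c (vb_proj e) ->
  fib c (vb_scale a e) = a *: fib c e.
Proof. by move=> ce; rewrite -{1}(phi_fib ce) -ch_scale // fib_phi. Qed.

(** The matrix, acting on row vectors, of the restriction of [f] to the fiber
    over [x], in the bases given by two charts.  For [f := id] this is a
    transition matrix. *)
Definition chart_mx c x c' (f : E -> E) : 'M[C]_(ch_dim c, ch_dim c') :=
  fun_mx (fun v => fib c' (f (ch_phi c (x, v)))).

Lemma chart_mxE c x c' y f v : fiberwise_linear x y f -> ch_dom c x ->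
  ch_dom c' y -> v *m chart_mx c x c' f = fib c' (f (ch_phi c (x, v))).
Proof.
move=> [fp fa fs] cx cy; apply: fun_mxE => a u w.
have cp u' : vb_proj (f (ch_phi c (x, u'))) = y by rewrite fp // ch_proj.
rewrite ch_add // fa ?ch_proj // fib_add ?cp // ch_scale // fs ?ch_proj //.
by rewrite fib_scale ?cp.
Qed.

Lemma chart_mx_comp c x c' y c'' z f g : fiberwise_linear x y f ->
  fiberwise_linear y z g -> ch_dom c x -> ch_dom c' y -> ch_dom c'' z ->
  chart_mx c x c'' (g \o f) = chart_mx c x c' f *m chart_mx c' y c'' g.
Proof.
move=> lf lg cx cy cz; have [fp fa fs] := lf; have [gp ga gs] := lg.
have lgf : fiberwise_linear x z (g \o f).
  split=> /=.
  - by move=> e ex; rewrite gp ?fp.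
  - by move=> e e' ex ex'; rewrite fa // ga ?fp.
  - by move=> a e ex; rewrite fs // gs ?fp.
apply: eq_mulmx_row => u; rewrite mulmxA (chart_mxE _ lgf) // (chart_mxE _ lf) //.
rewrite (chart_mxE _ lg) //=.
have py : vb_proj (f (ch_phi c (x, u))) = y by rewrite fp // ch_proj.
by rewrite -[in RHS]py phi_fib // py.
Qed.

Lemma chart_mx_id c x : ch_dom c x -> chart_mx c x c id = 1%:M.
Proof.
move=> cx; apply: eq_mulmx_row => u.
by rewrite (chart_mxE _ (fiberwise_linear_id x)) // fib_phi // mulmx1.
Qed.

Lemma chart_mx_scale c x c' y f g (a : C) : fiberwise_linear x y f ->
  ch_dom c x -> ch_dom c' y ->
  (forall e, vb_proj e = x -> g e = vb_scale a (f e)) ->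
  chart_mx c x c' g = a *: chart_mx c x c' f.
Proof.
move=> [fp _ _] cx cy gf; apply/matrixP => i j; rewrite !mxE.
rewrite gf ?ch_proj // fib_scale ?mxE // fp ?ch_proj //.
Qed.

Lemma chart_mx_eq c x c' f g : ch_dom c x ->
  (forall e, vb_proj e = x -> f e = g e) ->
  chart_mx c x c' f = chart_mx c x c' g.
Proof.
by move=> cx fg; apply/matrixP => i j; rewrite !mxE fg // ch_proj.
Qed.

(** Charts being homeomorphisms, it is enough to follow the images of the
    basis vectors. *)
Lemma chart_mx_cvg (Z : Type) (F : set_system Z) c c' (s : Z -> X)
    (f : Z -> E -> E) x (f0 : E -> E) :
  is_vbundle E -> Filter F ->
  (forall v, f z (ch_phi c (s z, v)) @[z --> F] --> f0 (ch_phi c (x, v))) ->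
  (forall v, ch_dom c' (vb_proj (f0 (ch_phi c (x, v))))) ->
  chart_mx c (s z) c' (f z) @[z --> F] --> chart_mx c x c' f0.
Proof.
move=> hE FF cf cy; apply: cvg_mx => i j; rewrite mxE.
apply: (@cvg_near_eq _ _ _
  (fun z => fib c' (f z (ch_phi c (s z, delta_mx 0 i))) 0 j)).
  by apply: nearW => z; rewrite mxE.
by apply: cvg_coord; apply: fib_cvg.
Qed.

End Theory.

End Charts.

Arguments ch_dom {R X E} c.
Arguments ch_dim {R X E} c.
Arguments ch_phi {R X E} c _.
Arguments ch_psi {R X E} c _.

(** * Conjugate bundles and the trivial line bundle *)

Section Conjugate.
Variables (R : realType) (X : topologicalType) (G : groupoid_data X).
Local Notation C := (cplx R).

Definition conj_vb (E : vbundle_data R X) : vbundle_data R X := {|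
  vb_total := E; vb_proj := @vb_proj _ _ E; vb_add := @vb_add _ _ E;
  vb_scale := fun a e => vb_scale a^* e |}.

Lemma conj_mxK m n (A : 'M[C]_(m, n)) : map_mx Num.conj (map_mx Num.conj A) = A.
Proof. by apply/matrixP => i j; rewrite !mxE conjCK. Qed.

Lemma conj_vb_is_vbundle E : is_vbundle E -> is_vbundle (conj_vb E).
Proof.
move=> hE; split; first exact: vb_proj_cts hE.
move=> x; have [c cx] := chart_ex hE x.
exists (ch_dom c), (ch_dim c), (fun p => ch_phi c (p.1, map_mx Num.conj p.2)),
  (fun e => (vb_proj e, map_mx Num.conj (fib c e))).
split.
- by split=> //; exact: ch_open.
- exact: ch_dim_gt0.
- split.
  + by move=> [y v] [/= cy _]; rewrite /preimage /= ch_proj.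
  + by move=> e ce; split.
  + by move=> [y v] /set_mem [/= cy _]; rewrite ch_proj // fib_phi // conj_mxK.
  + by move=> e /set_mem ce /=; rewrite conj_mxK phi_fib.
  + apply/subspace_continuousP => -[y v] [/= cy _].
    apply: phi_cvg => //; first exact: cvg_fst_within.
    by apply: cvg_conjmx; exact: cvg_snd_within.
  + apply/subspace_continuousP => e ce; apply: cvg_prod.
      by apply: cvg_within_filter; exact: vb_proj_cts hE e.
    by apply: cvg_conjmx; apply: fib_cvg => //; exact: cvg_within.
- by move=> y v cy /=; rewrite ch_proj.
- split=> [y v w cy|y a v cy] /=; first by rewrite map_mxD ch_add.
  by rewrite map_mxZ ch_scale.
Qed.

Lemma conj_admits (T : twist_data R G) :
  admits_twisted_vbundle T -> admits_twisted_vbundle (conj_twist T).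
Proof.
move=> [E [act [[hE ca a1 pa aM aD aZ] tw]]].
exists (conj_vb E), act; split.
  split=> //; first exact: conj_vb_is_vbundle.
  by move=> h a e se; exact: aZ.
by move=> z r e se; exact: tw.
Qed.

Definition line_vb : vbundle_data R X := {|
  vb_total := (X * 'rV[C]_1)%type; vb_proj := fst;
  vb_add := fun e e' => (e.1, e.2 + e'.2);
  vb_scale := fun a e => (e.1, a *: e.2) |}.

Lemma trivial_admits : lch_groupoid G ->
  admits_twisted_vbundle (trivial_twist R G).
Proof.
move=> hG; have gG := lch_is_groupoid hG.
exists line_vb, (fun p e => (rng p.1, circle_val p.2 *: e.2)).
split; last first.
  by move=> z [g w] [x v] /= se; rewrite scalerA.
split=> //=.
- split; first exact: fst_cts.
  move=> x; exists setT, 1%N, id, id; split=> //.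
    by split=> //; exact: openT.
  by split=> //; apply: continuous_subspaceT => p; exact: cvg_id.
- have c : continuous (fun p : (G * circle R) * (X * 'rV[C]_1) =>
      (rng p.1.1, circle_val p.1.2 *: p.2.2)).
    move=> p; apply: cvg_prod.
      exact: (cts_comp (cts_comp (@fst_cts _ _) (@fst_cts _ _)) (rng_cts hG)).
    apply: cvg_scalemx.
      exact: (cts_comp (cts_comp (@fst_cts _ _) (@snd_cts _ _)) (@circle_val_cts R)).
    exact: (cts_comp (@snd_cts _ _) (@snd_cts _ _)).
  exact: (continuous_subspaceT c).
- by move=> [x v] /=; rewrite (rng_unit gG) scale1r.
- move=> [g z] [h w] [x v] /= gh hx; rewrite (rng_mul gG) // scalerA.
  by [].
- by move=> [g z] [x v] [y w] /= gx gy; rewrite scalerDr.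
- by move=> [g z] a [x v] /= gx; rewrite !scalerA mulrC.
Qed.

End Conjugate.

(** * Tensor products of vector bundles *)

Section TensorProduct.
Variables (R : realType) (X : topologicalType) (E1 E2 : vbundle_data R X).
Local Notation C := (cplx R).
Variables (fr1 : X -> chart E1) (fr2 : X -> chart E2).

(** A tensor over [x] is encoded by its matrix of coordinates in the bases given
    by the charts [fr1 x] and [fr2 x].  These charts jump when [x] varies, and
    the topology is therefore not the one of a subset of X times matrices. *)
Record tens := Tens {
  tpt : X;
  tmx : 'M[C]_(ch_dim (fr1 tpt), ch_dim (fr2 tpt))
}.

HB.instance Definition _ := gen_eqMixin tens.
HB.instance Definition _ := gen_choiceMixin tens.

Section Change.
Variables (c1 : chart E1) (c2 : chart E2).

(** [tens_of] and [mx_of] are the change of coordinates from the charts [c1],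
    [c2] to the chosen ones, and back. *)
Definition tens_of (p : X * 'M[C]_(ch_dim c1, ch_dim c2)) : tens :=
  @Tens p.1 ((chart_mx c1 p.1 (fr1 p.1) id)^T *m p.2
             *m chart_mx c2 p.1 (fr2 p.1) id).

Definition mx_of (t : tens) : 'M[C]_(ch_dim c1, ch_dim c2) :=
  (chart_mx (fr1 (tpt t)) (tpt t) c1 id)^T *m tmx t
  *m chart_mx (fr2 (tpt t)) (tpt t) c2 id.

End Change.

(** The finest topology for which each [tens_of c1 c2] is continuous over the
    common domain of [c1] and [c2]. *)
Definition tens_open (O : set tens) := forall c1 c2,
  open [set p | (ch_dom c1 p.1 /\ ch_dom c2 p.1) /\ O (@tens_of c1 c2 p)].

Lemma open_chart_dom (c1 : chart E1) (c2 : chart E2) (T : topologicalType) :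
  open [set p : X * T | ch_dom c1 p.1 /\ ch_dom c2 p.1].
Proof.
have o1 := open_comp (fun p _ => @fst_cts X T p) (ch_open c1).
have o2 := open_comp (fun p _ => @fst_cts X T p) (ch_open c2).
exact: openI o1 o2.
Qed.

Lemma tens_openT : tens_open setT.
Proof.
move=> c1 c2; rewrite (_ : [set _ | _] = [set p | ch_dom c1 p.1 /\ ch_dom c2 p.1]).
  exact: open_chart_dom.
by apply/seteqP; split=> p //= [].
Qed.

Lemma tens_openI : setI_closed tens_open.
Proof.
move=> A B oA oB c1 c2; have := openI (oA c1 c2) (oB c1 c2).
congr open; apply/seteqP; split=> p /=; first by move=> [[? ?] [_ ?]].
by move=> [? [? ?]].
Qed.

Lemma tens_open_bigU (I : Type) (f : I -> set tens) :
  (forall i, tens_open (f i)) -> tens_open (\bigcup_i f i).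
Proof.
move=> of_ c1 c2; have := bigcup_open (D := setT) (fun i _ => of_ i c1 c2).
congr open; apply/seteqP; split=> p /=.
  by move=> [i _ [pc fp]]; split=> //; exists i.
by move=> [pc [i _ fp]]; exists i.
Qed.

HB.instance Definition _ :=
  isOpenTopological.Build tens tens_openT tens_openI tens_open_bigU.

Hypothesis fr1P : forall x, ch_dom (fr1 x) x.
Hypothesis fr2P : forall x, ch_dom (fr2 x) x.
Hypothesis hE1 : is_vbundle E1.
Hypothesis hE2 : is_vbundle E2.

Let id1 x : fiberwise_linear x x (@id E1) := @fiberwise_linear_id _ _ E1 x.
Let id2 x : fiberwise_linear x x (@id E2) := @fiberwise_linear_id _ _ E2 x.

Lemma mx_ofK (c1 : chart E1) (c2 : chart E2) t : ch_dom c1 (tpt t) ->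
  ch_dom c2 (tpt t) -> tens_of (tpt t, mx_of c1 c2 t) = t.
Proof.
case: t => x A /= x1 x2; rewrite /tens_of /mx_of /=; congr (Tens _).
rewrite !mulmxA -trmx_mul -(mulmxA (_ *m A)).
rewrite -(chart_mx_comp (id1 x) (id1 x)) // -(chart_mx_comp (id2 x) (id2 x)) //.
by rewrite !chart_mx_id // trmx1 mul1mx mulmx1.
Qed.

Lemma mx_of_tens_of (c1 c1' : chart E1) (c2 c2' : chart E2) x A :
  ch_dom c1 x -> ch_dom c1' x -> ch_dom c2 x -> ch_dom c2' x ->
  mx_of c1' c2' (@tens_of c1 c2 (x, A)) =
  (chart_mx c1 x c1' id)^T *m A *m chart_mx c2 x c2' id.
Proof.
move=> x1 x1' x2 x2'; rewrite /tens_of /mx_of /=.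
rewrite !mulmxA -trmx_mul -(mulmxA (_ *m A)).
by rewrite -(chart_mx_comp (id1 x) (id1 x)) // -(chart_mx_comp (id2 x) (id2 x)).
Qed.

Lemma tens_ofK (c1 : chart E1) (c2 : chart E2) x A :
  ch_dom c1 x -> ch_dom c2 x -> mx_of c1 c2 (@tens_of c1 c2 (x, A)) = A.
Proof.
by move=> x1 x2; rewrite mx_of_tens_of // !chart_mx_id // trmx1 mul1mx mulmx1.
Qed.

Lemma tens_of_cvg (Z : Type) (F : set_system Z) (c1 : chart E1) (c2 : chart E2)
    (s : Z -> X) (f : Z -> 'M[C]_(ch_dim c1, ch_dim c2)) x
    (A : 'M[C]_(ch_dim c1, ch_dim c2)) :
  Filter F -> ch_dom c1 x -> ch_dom c2 x -> s @ F --> x -> f @ F --> A ->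
  @tens_of c1 c2 (s z, f z) @[z --> F] --> @tens_of c1 c2 (x, A).
Proof.
move=> FF x1 x2 sx fA B; rewrite nbhsE => -[V [oV Vx] VB].
have oV' : open [set p | (ch_dom c1 p.1 /\ ch_dom c2 p.1) /\ V (@tens_of c1 c2 p)].
  by have oV0 : tens_open V := oV; exact: oV0.
have nV := cvg_open (cvg_prod FF sx fA) oV' (conj (conj x1 x2) Vx).
suff : F [set z | B (tens_of (s z, f z))] by [].
by apply: filterS nV => z [_ Vz]; exact: VB.
Qed.

Lemma tpt_cts : continuous tpt.
Proof.
apply/continuousP => V oV; suff : tens_open (tpt @^-1` V) by [].
move=> c1 c2.
have oV' := open_comp (fun p _ => @fst_cts X 'M[C]_(ch_dim c1, ch_dim c2) p) oV.
have := openI (@open_chart_dom c1 c2 'M[C]_(ch_dim c1, ch_dim c2)) oV'.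
by congr open; apply/seteqP; split.
Qed.

Lemma transition_cvg (E : vbundle_data R X) (c c' : chart E) (Z : Type)
    (F : set_system Z) (s : Z -> X) x : is_vbundle E -> Filter F ->
  s @ F --> x -> ch_dom c x -> ch_dom c' x ->
  chart_mx c (s z) c' id @[z --> F] --> chart_mx c x c' id.
Proof.
move=> hE FF sx cx cx'; apply: chart_mx_cvg => // v.
  by apply: phi_cvg => //; exact: cvg_cst.
by rewrite ch_proj.
Qed.

(** In charts, [mx_of] is A |-> P^T A Q with transition matrices [P], [Q] that
    depend continuously on the base point, so its preimages of open sets are
    open for the topology of [tens]. *)
Lemma mx_of_cvg (c1 : chart E1) (c2 : chart E2) t :
  ch_dom c1 (tpt t) -> ch_dom c2 (tpt t) ->
  mx_of c1 c2 @ nbhs t --> mx_of c1 c2 t.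
Proof.
move=> t1 t2 W; rewrite nbhsE => -[V [oV Vt] VW].
pose O := [set u : tens | (ch_dom c1 (tpt u) /\ ch_dom c2 (tpt u)) /\
                          V (mx_of c1 c2 u)].
suff oO : tens_open O.
  have nO : nbhs t O by apply: open_nbhs_nbhs.
  suff : nbhs t (mx_of c1 c2 @^-1` W) by [].
  by apply: filterS nO => u [_ Vu]; exact: VW.
move=> c1' c2'; rewrite openE => -[x A] [/= [x1' x2'] [/= [x1 x2] VA]].
rewrite mx_of_tens_of // in VA.
pose M (p : X * 'M[C]_(ch_dim c1', ch_dim c2')) :=
  (chart_mx c1' p.1 c1 id)^T *m p.2 *m chart_mx c2' p.1 c2 id.
have cM : M @ nbhs (x, A) --> M (x, A).
  have f1 := @fst_cts X 'M[C]_(ch_dim c1', ch_dim c2') (x, A).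
  have f2 := @snd_cts X 'M[C]_(ch_dim c1', ch_dim c2') (x, A).
  apply: cvg_mulmx; last exact: transition_cvg.
  by apply: cvg_mulmx => //; apply: cvg_trmx; exact: transition_cvg.
have nV := cvg_open cM oV VA.
have n1 : \forall p \near (x, A), ch_dom c1 p.1 /\ ch_dom c2 p.1.
  by apply: open_nbhs_nbhs; split; [exact: open_chart_dom|].
have n2 : \forall p \near (x, A), ch_dom c1' p.1 /\ ch_dom c2' p.1.
  by apply: open_nbhs_nbhs; split; [exact: open_chart_dom|].
apply: filterS3 nV n1 n2 => -[y B] VB [/= y1 y2] [/= y1' y2'].
by split=> //; split=> //=; rewrite mx_of_tens_of.
Qed.

(** The transition matrices are identities when both tensors lie in the same
    fiber; they spare a cast between types of matrices. *)
Definition tens_add (t u : tens) : tens :=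
  @Tens (tpt t) (tmx t +
    (chart_mx (fr1 (tpt u)) (tpt u) (fr1 (tpt t)) id)^T *m tmx u
    *m chart_mx (fr2 (tpt u)) (tpt u) (fr2 (tpt t)) id).

Definition tens_vb : vbundle_data R X := {|
  vb_total := tens; vb_proj := tpt; vb_add := tens_add;
  vb_scale := fun a t => @Tens (tpt t) (a *: tmx t) |}.

Lemma tens_addE x A B : tens_add (@Tens x A) (@Tens x B) = @Tens x (A + B).
Proof. by rewrite /tens_add /= !chart_mx_id // trmx1 mul1mx mulmx1. Qed.

Lemma tens_is_vbundle : is_vbundle tens_vb.
Proof.
split; first exact: tpt_cts.
move=> x; pose c1 := fr1 x; pose c2 := fr2 x.
pose n := (ch_dim c1 * ch_dim c2)%N.
exists (ch_dom c1 `&` ch_dom c2), n,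
  (fun p : X * 'rV[C]_n => @tens_of c1 c2 (p.1, vec_mx p.2)),
  (fun t : tens => (tpt t, mxvec (mx_of c1 c2 t))).
split.
- split; last by split; [exact: fr1P|exact: fr2P].
  by apply: openI; exact: ch_open.
- by rewrite muln_gt0 !ch_dim_gt0.
- split.
  + by move=> [y v] [/= cy _].
  + by move=> t ct; split.
  + by move=> [y v] /set_mem [/= [y1 y2] _]; rewrite tens_ofK // vec_mxK.
  + by move=> t /set_mem [/= t1 t2]; rewrite mxvecK mx_ofK.
  + apply/subspace_continuousP => -[y v] [/= [y1 y2] _].
    apply: tens_of_cvg => //; first exact: cvg_fst_within.
    by apply: cvg_vec_mx; exact: cvg_snd_within.
  + apply/subspace_continuousP => t [t1 t2]; apply: cvg_prod.
      by apply: cvg_within_filter; exact: tpt_cts.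
    by apply: cvg_mxvec; apply: cvg_within_filter; exact: mx_of_cvg.
- by [].
- split=> [y v w _|y a v _] /=; rewrite /tens_of /=.
    by rewrite tens_addE linearD mulmxDr mulmxDl.
  by rewrite linearZ /= -scalemxAr -scalemxAl.
Qed.

End TensorProduct.

(** * The action of the Baer sum on the tensor product *)

Section TensorAction.
Variables (R : realType) (X : topologicalType) (G : groupoid_data X).
Hypothesis hG : lch_groupoid G.
Variables T1 T2 : twist R G.
Variables (E1 E2 : vbundle_data R X) (act1 : T1 -> E1 -> E1).
Variable (act2 : T2 -> E2 -> E2).
Hypothesis hA1 : is_twisted_vbundle act1.
Hypothesis hA2 : is_twisted_vbundle act2.
Local Notation C := (cplx R).
Local Notation S := (baer_tw hG T1 T2).

Let hE1 := gvb_vbundle hA1.1.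
Let hE2 := gvb_vbundle hA2.1.
Let fr1 := frame hE1.
Let fr2 := frame hE2.
Let fr1P x : ch_dom (fr1 x) x := frameP hE1 x.
Let fr2P x : ch_dom (fr2 x) x := frameP hE2 x.
Local Notation E := (tens_vb fr1 fr2).
Let h1 := twistP T1.
Let h2 := twistP T2.
Let g1 := lch_is_groupoid (tw_lch h1).
Let g2 := lch_is_groupoid (tw_lch h2).

Lemma act_fiberwise_linear (T : twist R G) (V : vbundle_data R X)
    (act : T -> V -> V) r : is_twisted_vbundle act ->
  fiberwise_linear (src r) (rng r) (act r).
Proof.
move=> [hV _]; split.
- by move=> e er; exact: (gvb_proj_act hV).
- by move=> e e' er er'; exact: (gvb_actD hV).
- by move=> a e er; exact: (gvb_actZ hV).
Qed.

(** The action of [r1] tensor [r2], in coordinates.  Both matrices refer to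
    [rng r1], which is also [rng r2] when [(r1, r2)] is in the fiber product:
    this avoids casts between types of matrices. *)
Definition pair_act (r1 : T1) (r2 : T2) (t : E) : E :=
  @Tens _ _ _ _ fr1 fr2 (rng r1)
    ((chart_mx (fr1 (tpt t)) (tpt t) (fr1 (rng r1)) (act1 r1))^T *m tmx t
     *m chart_mx (fr2 (tpt t)) (tpt t) (fr2 (rng r1)) (act2 r2)).

Definition tens_act (x : S) (t : E) : E :=
  pair_act (fp1 (repr (x : baer_space T1 T2)))
           (fp2 (repr (x : baer_space T1 T2))) t.

Lemma src_rng_eq (r1 : T1) (r2 : T2) : tw_pi r1 = tw_pi r2 ->
  src r2 = src r1 /\ rng r2 = rng r1.
Proof.
move=> e; rewrite -(hom_src (tw_hom h2)) -e (hom_src (tw_hom h1)).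
by rewrite -(hom_rng (tw_hom h2)) -e (hom_rng (tw_hom h1)).
Qed.

Lemma act1_linear (r1 : T1) : fiberwise_linear (src r1) (rng r1) (act1 r1).
Proof. exact: act_fiberwise_linear. Qed.

Lemma act2_linear (r1 : T1) (r2 : T2) : tw_pi r1 = tw_pi r2 ->
  fiberwise_linear (src r1) (rng r1) (act2 r2).
Proof. by move=> /src_rng_eq[<- <-]; exact: act_fiberwise_linear. Qed.

Lemma pair_act_scale (r1 : T1) (r2 : T2) z1 z2 t : tw_pi r1 = tw_pi r2 ->
  src r1 = tpt t -> pair_act (tw_act z1 r1) (tw_act z2 r2) t =
  vb_scale (circle_val z1 * circle_val z2) (pair_act r1 r2 t).
Proof.
case: t => x A e /= rt; subst x.
have [es er] := src_rng_eq e; rewrite /pair_act (rng_act h1) /=.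
congr (Tens _).
rewrite (chart_mx_scale (a := circle_val z1) (act1_linear r1)) ?fr1P //;
  last first.
  by move=> v vp; apply: hA1.2; rewrite vp.
rewrite (chart_mx_scale (a := circle_val z2) (act2_linear e)) ?fr2P //;
  last first.
  by move=> v vp; apply: hA2.2; rewrite es vp.
have trZ (a : C) m n (M : 'M[C]_(m, n)) : (a *: M)^T = a *: M^T.
  by apply/matrixP => i j; rewrite !mxE.
by rewrite trZ -!scalemxAl -scalemxAr scalerA.
Qed.

(** The scalars introduced by a change of representatives cancel out. *)
Lemma tens_act_bclass (r1 : T1) (r2 : T2) t : tw_pi r1 = tw_pi r2 ->
  src r1 = tpt t -> tens_act (bclass r1 r2) t = pair_act r1 r2 t.
Proof.
move=> e rt; have [w [e1 e2]] := repr_bclass e; rewrite /tens_act e1 e2.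
rewrite pair_act_scale //; have := circleCr w.
move=> /(congr1 (@circle_val R)); rewrite /circleM !mk_circleK => ->.
by case: (pair_act _ _ _) => x A /=; rewrite scale1r.
Qed.

(** Over fixed charts around the source and the range, all the matrices involved
    depend continuously on [r1], [r2] and [t]; the charts chosen at [src r1] and
    [rng r1] only enter through [tens_of] and [mx_of]. *)
Lemma pair_act_charts (c1 c1' : chart E1) (c2 c2' : chart E2)
    (r1 : T1) (r2 : T2) t :
  tw_pi r1 = tw_pi r2 -> src r1 = tpt t ->
  ch_dom c1 (src r1) -> ch_dom c2 (src r1) -> ch_dom c1' (rng r1) ->
  ch_dom c2' (rng r1) -> pair_act r1 r2 t =
  tens_of fr1 fr2 (rng r1, (chart_mx c1 (src r1) c1' (act1 r1))^T *m mx_of c1 c2 t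
     *m chart_mx c2 (src r1) c2' (act2 r2)).
Proof.
case: t => x A e /= rt; subst x => x1 x2 y1 y2.
rewrite /pair_act /tens_of /=; congr (Tens _).
have id1 x := @fiberwise_linear_id _ _ E1 x.
have id2 x := @fiberwise_linear_id _ _ E2 x.
pose x := src r1; pose y := rng r1.
have k1 : chart_mx (fr1 x) x (fr1 y) (act1 r1) = chart_mx (fr1 x) x c1 id
    *m (chart_mx c1 x c1' (act1 r1) *m chart_mx c1' y (fr1 y) id).
  rewrite -(chart_mx_comp (act1_linear r1) (id1 _)) ?fr1P //.
  by rewrite -(chart_mx_comp (id1 _) (act1_linear r1)) ?fr1P.
have k2 : chart_mx (fr2 x) x (fr2 y) (act2 r2) = chart_mx (fr2 x) x c2 id
    *m (chart_mx c2 x c2' (act2 r2) *m chart_mx c2' y (fr2 y) id).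
  rewrite -(chart_mx_comp (act2_linear e) (id2 _)) ?fr2P //.
  by rewrite -(chart_mx_comp (id2 _) (act2_linear e)) ?fr2P.
by rewrite k1 k2 /mx_of /= !trmx_mul !mulmxA.
Qed.

Lemma act_mx_cvg (T : twist R G) (V : vbundle_data R X) (act : T -> V -> V)
    (Z : Type) (F : set_system Z) (c c' : chart V) (f : Z -> T) (r : T) :
  is_twisted_vbundle act -> Filter F -> f @ F --> r ->
  ch_dom c (src r) -> ch_dom c' (rng r) ->
  chart_mx c (src (f z)) c' (act (f z)) @[z --> F]
    --> chart_mx c (src r) c' (act r).
Proof.
move=> hA FF fr cr cr'; have hV := gvb_vbundle hA.1.
have cs := src_cts (tw_lch (twistP T)).
have fs : src (f z) @[z --> F] --> src r by exact: (cvg_cts FF cs fr).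
apply: chart_mx_cvg => // v; last first.
  by rewrite (gvb_proj_act hA.1) ?ch_proj.
apply: (@cvg_within_comp _ _ _ _ (fun q => act q.1 q.2)
  (fun z => (f z, ch_phi c (src (f z), v))) _ (r, ch_phi c (src r, v)) _
  (gvb_act_cts hA.1)).
- by rewrite /= ch_proj.
- by apply: cvg_prod => //; apply: phi_cvg => //; exact: cvg_cst.
- have nU : \forall z \near F, ch_dom c (src (f z)) := cvg_open fs (ch_open c) cr.
  by apply: filterS nU => z Uz /=; rewrite ch_proj.
Qed.

Lemma act_mx_unit (T : twist R G) (V : vbundle_data R X) (act : T -> V -> V)
    (c : chart V) x :
  is_twisted_vbundle act -> ch_dom c x ->
  chart_mx c x c (act (unit_at T x)) = 1%:M.
Proof.
move=> hA cx; rewrite -(chart_mx_id cx); apply: chart_mx_eq => // v <-.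
exact: (gvb_act_unit hA.1).
Qed.

Lemma act_mx_mul (T : twist R G) (V : vbundle_data R X) (act : T -> V -> V)
    (c c' c'' : chart V) (r s : T) x y z :
  is_twisted_vbundle act -> src s = x -> rng s = y -> src r = y -> rng r = z ->
  ch_dom c x -> ch_dom c' y -> ch_dom c'' z ->
  chart_mx c x c'' (act (gmul r s)) =
  chart_mx c x c' (act s) *m chart_mx c' y c'' (act r).
Proof.
move=> hA sx sy ry rz cx cy cz.
have ls : fiberwise_linear x y (act s).
  by rewrite -sx -sy; exact: act_fiberwise_linear.
have lr : fiberwise_linear y z (act r).
  by rewrite -ry -rz; exact: act_fiberwise_linear.
rewrite -(chart_mx_comp ls lr) //; apply: chart_mx_eq => // v vx /=.
by rewrite (gvb_actM hA.1) // ?ry ?sy // sx.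
Qed.

Lemma tens_act_cts : {within [set p : S * E | src p.1 = vb_proj p.2],
  continuous (fun p => tens_act p.1 p.2)}.
Proof.
apply: (cts_open_map (open_map_prod (@baer_open_map _ _ _ T1 T2) (@open_map_id E))).
  by move=> [x t]; have [p <-] := baer_pi_surj x; exists (p, t).
apply/subspace_continuousP => -[p t] pt0.
have spE (u : fiber_prod_space T1 T2 * E) :
    src (\pi_(baer_space T1 T2) u.1 : S) = vb_proj u.2 -> src (fp1 u.1) = tpt u.2.
  by move=> e; rewrite -src_pi; exact: e.
have pt : src (fp1 p) = tpt t := spE (p, t) pt0.
set A := (X in within X).
have nA : \forall u \near within A (nbhs (p, t)), src (fp1 u.1) = tpt u.2.
  by apply: filterS (near_withinA A (p, t)) => u; exact: spE.
have tE (u : fiber_prod_space T1 T2 * E) : src (fp1 u.1) = tpt u.2 ->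
    tens_act (\pi_(baer_space T1 T2) u.1) u.2 = pair_act (fp1 u.1) (fp2 u.1) u.2.
  by move=> e; rewrite pi_bclass tens_act_bclass // fp_pi.
rewrite -[X in _ --> X]/(tens_act (\pi_(baer_space T1 T2) p) t) (tE (p, t) pt).
apply: (@cvg_near_eq _ _ _ (fun u : fiber_prod_space T1 T2 * E =>
    pair_act (fp1 u.1) (fp2 u.1) u.2)).
  by apply: filterS nA => u; exact: tE.
pose x := src (fp1 p); pose y := rng (fp1 p).
have c1x : ch_dom (fr1 x) x by first [exact: fr1P|exact: fr2P].
have c2x : ch_dom (fr2 x) x by first [exact: fr1P|exact: fr2P].
have c1y : ch_dom (fr1 y) y by first [exact: fr1P|exact: fr2P].
have c2y : ch_dom (fr2 y) y by first [exact: fr1P|exact: fr2P].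
have f1 : fp1 u.1 @[u --> within A (nbhs (p, t))] --> fp1 p.
  exact: (cvg_cts _ (@fp1_cts _ _ _ T1 T2) (@cvg_fst_within _ _ A (p, t))).
have f2 : fp2 u.1 @[u --> within A (nbhs (p, t))] --> fp2 p.
  exact: (cvg_cts _ (@fp2_cts _ _ _ T1 T2) (@cvg_fst_within _ _ A (p, t))).
have f3 : u.2 @[u --> within A (nbhs (p, t))] --> t.
  exact: (@cvg_snd_within _ _ A (p, t)).
have fs : src (fp1 u.1) @[u --> within A (nbhs (p, t))] --> x.
  exact: (cvg_cts _ (src_cts (tw_lch h1)) f1).
have fr : rng (fp1 u.1) @[u --> within A (nbhs (p, t))] --> y.
  exact: (cvg_cts _ (rng_cts (tw_lch h1)) f1).
have s2 (q : fiber_prod_space T1 T2) : src (fp1 q) = src (fp2 q).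
  by have [] := src_rng_eq (fp_pi q).
have r2 (q : fiber_prod_space T1 T2) : rng (fp1 q) = rng (fp2 q).
  by have [] := src_rng_eq (fp_pi q).
rewrite (pair_act_charts (fp_pi p) pt c1x c2x c1y c2y).
apply: (@cvg_near_eq _ _ _ (fun u : fiber_prod_space T1 T2 * E =>
   tens_of fr1 fr2 (rng (fp1 u.1),
     (chart_mx (fr1 x) (src (fp1 u.1)) (fr1 y) (act1 (fp1 u.1)))^T
     *m mx_of (fr1 x) (fr2 x) u.2
     *m chart_mx (fr2 x) (src (fp1 u.1)) (fr2 y) (act2 (fp2 u.1))))).
  have n1 := cvg_open fs (openI (ch_open (fr1 x)) (ch_open (fr2 x))) (conj c1x c2x).
  have n2 := cvg_open fr (openI (ch_open (fr1 y)) (ch_open (fr2 y))) (conj c1y c2y).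
  apply: filterS3 nA n1 n2 => u e [u1 u2] [u3 u4].
  by apply: pair_act_charts => //; exact: fp_pi.
have FA : Filter (within A (nbhs (p, t))) by exact: within_filter.
apply: tens_of_cvg => //.
apply: (@cvg_mulmx R _ _ FA); first apply: (@cvg_mulmx R _ _ FA).
- by apply: cvg_trmx; apply: (act_mx_cvg hA1).
- apply: (cvg_at_comp _ _ f3); apply: mx_of_cvg => //.
  + by rewrite -pt.
  + by rewrite -pt.
- rewrite (s2 p).
  apply: (@cvg_near_eq _ _ _ (fun u : fiber_prod_space T1 T2 * E =>
      chart_mx (fr2 x) (src (fp2 u.1)) (fr2 y) (act2 (fp2 u.1)))).
    by apply: nearW => u; rewrite s2.
  by apply: (act_mx_cvg hA2) => //; rewrite -?s2 -?r2.
Qed.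

Lemma tens_is_twisted : is_twisted_vbundle (tens_act : S -> E -> E).
Proof.
split; last first.
  move=> z x [y A]; have [r1 [r2 [e ->]]] := bclassP x.
  rewrite [src _]src_bclass // => ry0; have {ry0} ry : src r1 = y := ry0.
  have -> : tw_act z (bclass r1 r2 : S) = bclass (tw_act z r1) r2.
    exact: tw_act_bclass.
  rewrite tens_act_bclass ?(src_act h1) ?(pcb_act_fiber (tw_bundle h1)) //.
  rewrite tens_act_bclass // -[r2 in LHS](pcb_act1 (tw_bundle h2)).
  by rewrite pair_act_scale // mulr1.
split.
- by apply: tens_is_vbundle => // x; first [exact: fr1P|exact: fr2P].
- exact: tens_act_cts.
- move=> [x A]; rewrite [unit_at _ _]unit_bclass.
  have e : tw_pi (unit_at T1 x) = tw_pi (unit_at T2 x).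
    by rewrite (hom_unit (tw_hom h1)) (hom_unit (tw_hom h2)).
  rewrite tens_act_bclass // ?(src_unit g1) // /pair_act (rng_unit g1) /=.
  congr (Tens _).
  rewrite (act_mx_unit hA1) ?fr1P ?fr2P // (act_mx_unit hA2) ?fr1P ?fr2P //.
  by rewrite trmx1 mul1mx mulmx1.
- move=> x t; have [r1 [r2 [e ->]]] := bclassP x.
  by rewrite [src _]src_bclass.
- move=> x y [z A]; have [r1 [r2 [e ->]]] := bclassP x.
  have [s1 [s2 [f ->]]] := bclassP y.
  rewrite [src _]src_bclass // [rng _]rng_bclass // => rs.
  rewrite [src _]src_bclass // => sz0.
  have {sz0} sz : src s1 = z := sz0; subst z.
  have rs2 := bclass_src_rng e f rs.
  rewrite (tens_act_bclass f) // tens_act_bclass // [gmul _ _]gmul_bclass //.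
  rewrite tens_act_bclass ?(src_mul g1) //; last exact: pi_gmul.
  rewrite /pair_act (rng_mul g1) //=; congr (Tens _).
  have [es1 er1] := src_rng_eq e; have [es2 er2] := src_rng_eq f.
  rewrite (act_mx_mul (c' := fr1 (rng s1)) (y := rng s1) (z := rng r1) hA1)
    ?fr1P //.
  rewrite (act_mx_mul (c' := fr2 (rng s1)) (y := rng s1) (z := rng r1) hA2)
    ?fr2P // ?es1 //.
  by rewrite trmx_mul !mulmxA.
- move=> x [y A] [z B]; have [r1 [r2 [e ->]]] := bclassP x.
  rewrite [src _]src_bclass // => /= ry rz; subst y z.
  rewrite tens_addE // !tens_act_bclass // /pair_act /= tens_addE //.
  by rewrite mulmxDr mulmxDl.
- move=> x a [y A]; have [r1 [r2 [e ->]]] := bclassP x.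
  rewrite [src _]src_bclass // => ry0.
  have {ry0} ry : src r1 = y := ry0; subst y.
  rewrite (tens_act_bclass e (t := @Tens _ _ _ _ fr1 fr2 (src r1) A)) //.
  by rewrite tens_act_bclass // /pair_act /= -scalemxAr -scalemxAl.
Qed.

End TensorAction.

Lemma baer_admits (R : realType) (X : topologicalType) (G : groupoid_data X)
    (hG : lch_groupoid G) (T1 T2 : twist R G) :
  admits_twisted_vbundle T1 -> admits_twisted_vbundle T2 ->
  admits_twisted_vbundle (baer_tw hG T1 T2).
Proof.
move=> [E1 [act1 hA1]] [E2 [act2 hA2]].
exists (tens_vb (frame (gvb_vbundle hA1.1)) (frame (gvb_vbundle hA2.1))).
by exists (@tens_act _ _ _ hG T1 T2 _ _ _ _ hA1 hA2); exact: tens_is_twisted.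
Qed.

Theorem proposition3p2 (R : realType) (X : topologicalType)
    (G : groupoid_data X) (hG : lch_groupoid G) (hX : cw_complex R X) :
  is_subgroup (@Tw_tau R X G) (@Tw R X G)
    (@tw_add R X G) (@tw_zero R X G) (@tw_opp R X G).
Proof.
have tauS a : Tw_tau a -> @Tw R X G a by move=> [T _ ->]; exists T.
have [_ _ _ addA add0 addr0 addN addrN] := Tw_is_group R hG.
split=> //; first exact: Tw_is_group.
split=> //.
- move=> _ _ [T1 hT1 ->] [T2 hT2 ->]; exists (baer_tw hG T1 T2).
    exact: baer_admits.
  exact: tw_add_class.
- by exists (trivial_tw R hG) => //; exact: trivial_admits.
- move=> _ [T hT ->]; exists (conj_tw T); last exact: tw_opp_class.
  exact: conj_admits.
- by move=> a b c /tauS ha /tauS hb /tauS hc; exact: addA.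
- by move=> a /tauS; exact: add0.
- by move=> a /tauS; exact: addr0.
- by move=> a /tauS; exact: addN.
- by move=> a /tauS; exact: addrN.
Qed.
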